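(* Let $p>3$ be a prime and let $\beta_k=\sum_{j=0}^{k}\binom{k}{j}^2\binom{k+j}{j}$. Then \[\sum_{k=0}^{p-1}(11k^2+13k+4)\beta_k\equiv 4p^2+4p^7B_{p-5}\pmod{p^8},\] \[\sum_{k=0}^{p-1}(11k^2+9k+2)(-1)^{k}\beta_k\equiv 2p^2+10p^3H_{p-1}-p^7B_{p-5}\pmod{p^8},\] and \[\sum_{k=0}^{p-1}(11k^3+7k^2-1)(-1)^{k}\beta_k\equiv 2p^3-3p^2+(10p-5)p^3H_{p-1}-\tfrac32p^7B_{p-5}\pmod{p^8},\] where $H_{p-1}=\sum_{k=1}^{p-1}\frac1k$.
   Context: Bernoulli numbers $B_0,B_1,\dots$ are defined by $B_0=1$ and $\sum_{k=0}^{n}\binom{n+1}{k}B_k=0$ for all $n\ge1$. Congruences between rational numbers modulo $p^m$ are understood in the ring of rationals whose denominators are prime to $p$. *)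

(* Defs.v *)
From mathcomp Require Import all_boot all_order all_algebra.

Set Implicit Arguments.
Unset Strict Implicit.
Unset Printing Implicit Defensive.

Import Order.TTheory GRing.Theory Num.Theory.
Local Open Scope ring_scope.

(* [:: B_0; ...; B_(n-1)], where B_m is the defining identity
   \sum_(k <= m) 'C(m + 1, k) B_k = 0 solved for its last term;
   see bernoulli0, bernoulli_sum and bernoulli_unique. *)
Fixpoint bernoulli_seq (n : nat) : seq rat :=
  if n is m.+1 then
    let s := bernoulli_seq m in
    rcons s (if m == 0%N then 1
             else - (\sum_(0 <= k < m) 'C(m.+1, k)%:R * s`_k) / m.+1%:R)
  else [::].

Definition bernoulli (n : nat) : rat := (bernoulli_seq n.+1)`_n.

Lemma size_bernoulli_seq (n : nat) : size (bernoulli_seq n) = n.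
Proof. by elim: n => //= n IHn; rewrite size_rcons IHn. Qed.

Lemma nth_bernoulli_seq (n k : nat) :
  (k < n)%N -> (bernoulli_seq n)`_k = bernoulli k.
Proof.
elim: n => // n IHn; rewrite ltnS leq_eqVlt => /predU1P[-> // | lt_kn].
by rewrite /= nth_rcons size_bernoulli_seq lt_kn IHn.
Qed.

Lemma bernoulli0 : bernoulli 0 = 1.
Proof. by []. Qed.

Lemma bernoulliE (n : nat) : (0 < n)%N ->
  bernoulli n =
    - (\sum_(0 <= k < n) 'C(n.+1, k)%:R * bernoulli k) / n.+1%:R.
Proof.
move=> n_gt0; rewrite /bernoulli [bernoulli_seq n.+1]/=.
rewrite nth_rcons size_bernoulli_seq ltnn eqxx -[n == 0%N]negbK -lt0n n_gt0 /=.
congr (- _ / _); apply: eq_big_nat => k /andP[_ lt_kn].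
by rewrite nth_bernoulli_seq.
Qed.

Lemma bernoulli_sum (n : nat) : (0 < n)%N ->
  \sum_(0 <= k < n.+1) 'C(n.+1, k)%:R * bernoulli k = 0.
Proof.
move=> n_gt0; rewrite big_nat_recr //= binSn (bernoulliE n_gt0).
by rewrite mulrC divfK ?subrr // pnatr_eq0.
Qed.

Lemma bernoulli_unique (b : nat -> rat) :
  b 0%N = 1 ->
  (forall n : nat, (0 < n)%N ->
     \sum_(0 <= k < n.+1) 'C(n.+1, k)%:R * b k = 0) ->
  b =1 bernoulli.
Proof.
move=> b0 b_sum; elim/ltn_ind=> -[_ | n IHn]; first by rewrite b0.
have nz : n.+2%:R != 0 :> rat by rewrite pnatr_eq0.
apply: (mulfI nz); apply: (@addrI _ (\sum_(0 <= k < n.+1) 'C(n.+2, k)%:R * b k)).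
have := b_sum n.+1 isT; rewrite big_nat_recr //= binSn => ->.
rewrite (@eq_big_nat _ _ _ _ _ _ (fun k => 'C(n.+2, k)%:R * bernoulli k)).
  by have := @bernoulli_sum n.+1 isT; rewrite big_nat_recr //= binSn => ->.
by move=> k /andP[_ lt_kn]; rewrite IHn.
Qed.

Definition beta (k : nat) : nat :=
  (\sum_(0 <= j < k.+1) 'C(k, j) ^ 2 * 'C(k + j, j))%N.

Definition harmonic (n : nat) : rat := \sum_(1 <= k < n.+1) k%:R^-1.

(* Membership in the ring of rationals with denominator prime to p. *)
Definition p_integral (p : nat) (x : rat) : bool := coprime p `|denq x|.

(* x = y modulo the ideal generated by p ^ m in that ring. *)
Definition eqmod_pow (p m : nat) (x y : rat) : Prop :=
  [/\ p_integral p x, p_integral p y &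
      exists2 c : rat, p_integral p c & x - y = p%:R ^+ m * c].

(* Main.v *)
(* Apery's recurrence makes the three sums telescope: they are combinations of
   p^2 beta_p and p^2 beta_(p-1), so both values are needed modulo p^6.

   Put W(x, j) = prod_(i < j) (1 - x/i)^2 (1 + x/i) and T(x) = sum_(j <= p) W(x, j) (p/j)^3.
   The two expressions sum_j C(n,j)^2 C(n+j,j) and
   sum_j (-1)^(n-j) C(n,j) C(n+j,j)^2 of beta_n, together with a telescoping of W,
   give 3 beta_p + beta_(p-1) = 5 + 5 T(p) and beta_p - 3 beta_(p-1) = -5 + 5 T(-p).
   Because of the factor p^3, W is needed only modulo p^3 for j < p, so T(p) and T(-p)
   involve only sums of 1/j^3, H_(j-1)/j^3, H_(j-1)^2/j^3 and H^(2)_(j-1)/j^3.  The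
   reflection j -> p - j reduces these to sum 1/j^4 modulo p^2, sum H_(j-1)/j^4 and
   sum H^(2)_(j-1)/j^3 modulo p, which Faulhaber's formula expresses by B_(p-5).
   The terms j = p are P and P^2 with P = prod_(i < p) (1 + p/i), and P is expressed
   by H_(p-1) through P^2 = prod_i (1 + 2 p^2 / (i (p - i))).

   The prime 5 is checked directly: for it p - 1 divides 4, and the evaluation of
   sum 1/j^4 divides by 2^4 - 1. *)
Require Import Defs.
From mathcomp Require Import all_boot all_order all_algebra.
From mathcomp Require Import cyclic ring lra zify.

Import Order.TTheory GRing.Theory Num.Theory.
Local Open Scope ring_scope.

(** * Identities between binomial sums *)

Lemma natrS_neq0 n : n.+1%:R != 0 :> rat.
Proof. by rewrite pnatr_eq0. Qed.

Lemma natr_bin_left n k :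
  'C(n, k.+1)%:R = 'C(n, k)%:R * (n%:R - k%:R) / k.+1%:R :> rat.
Proof.
apply: (mulIf (natrS_neq0 k)); rewrite divfK ?natrS_neq0 //.
have [le_kn|lt_nk] := leqP k n.
  by rewrite -natrB // -!natrM mulnC mul_bin_left mulnC.
by rewrite !bin_small ?mul0r // ltnW.
Qed.

Lemma natr_bin_diag n k :
  'C(n.+1, k.+1)%:R = 'C(n, k)%:R * n.+1%:R / k.+1%:R :> rat.
Proof.
apply: (mulIf (natrS_neq0 k)); rewrite divfK ?natrS_neq0 //.
by rewrite -!natrM mulnC -mul_bin_diag mulnC.
Qed.

Lemma natr_bin_down n k :
  'C(n, k)%:R = 'C(n.+1, k)%:R * (n.+1%:R - k%:R) / n.+1%:R :> rat.
Proof.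
apply: (mulIf (natrS_neq0 n)); rewrite divfK ?natrS_neq0 //.
have [le_kn|lt_nk] := leqP k n.+1.
  by rewrite -natrB // -!natrM mulnC mul_bin_down mulnC.
by rewrite !bin_small ?mul0r // ltnW.
Qed.

Definition beta_term (n k : nat) : rat := 'C(n, k)%:R ^+ 2 * 'C(n + k, k)%:R.

(** Terms beyond [n] vanish, so values of [beta] at neighbouring indices can be summed over one
    common range. *)
Lemma betaE N n : (n < N)%N -> (beta n)%:R = \sum_(0 <= k < N) beta_term n k.
Proof.
move=> lt_nN; have z : \sum_(n.+1 <= k < N) beta_term n k = 0.
  rewrite big_nat big1 // => k /andP[lt_nk _].
  by rewrite /beta_term bin_small // expr0n mul0r.
rewrite (big_cat_nat (leq0n n.+1) lt_nN) /= z addr0 /beta natr_sum.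
by apply: eq_bigr => k _; rewrite natrM natrX.
Qed.

Lemma natr_bin_up m k :
  'C(m.+1 + k, k)%:R = 'C(m + k, k)%:R * (m.+1 + k)%:R / m.+1%:R :> rat.
Proof.
rewrite (natr_bin_down (m + k) k) -addSn.
have -> : (m.+1 + k)%:R - k%:R = m.+1%:R :> rat by rewrite natrD addrK.
have nz : (m.+1 + k)%:R != 0 :> rat by rewrite pnatr_eq0.
by rewrite divfK // mulfK // natrS_neq0.
Qed.

(* The certificate is Apery's, as given by van der Poorten. *)
Lemma beta_rec n :
  n.+2%:R ^+ 2 * (beta n.+2)%:R =
    (11 * n.+1%:R ^+ 2 + 11 * n.+1%:R + 3) * (beta n.+1)%:R
    + n.+1%:R ^+ 2 * (beta n)%:R :> rat.
Proof.
pose r k : rat := n.+2%:R ^+ 2 * beta_term n.+2 k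
  - (11 * n.+1%:R ^+ 2 + 11 * n.+1%:R + 3) * beta_term n.+1 k
  - n.+1%:R ^+ 2 * beta_term n k.
pose B k : rat := (k%:R ^+ 2 + 3 * (2 * n.+1%:R + 1) * k%:R - 11 * n.+1%:R ^+ 2
  - 9 * n.+1%:R - 2) * beta_term n.+1 k.
have sumr K : \sum_(0 <= k < K.+1) r k = B K.
  elim: K => [|k IH].
    by rewrite big_nat1 /r /B /beta_term !bin0 -!natr1; ring.
  rewrite big_nat_recr //= IH /r /B /beta_term.
  rewrite (natr_bin_down n k.+1) (natr_bin_left n.+1 k) (natr_bin_diag n.+1 k).
  rewrite !addnS (natr_bin_diag (n.+2 + k) k) (natr_bin_up n.+1 k).
  rewrite (natr_bin_diag (n.+1 + k) k) -addSn (natr_bin_left (n.+1 + k) k).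
  have nz1 := natrS_neq0 n; have nz2 := natrS_neq0 n.+1; have nz3 := natrS_neq0 k.
  move: nz1 nz2 nz3; rewrite !addSn -!natr1 !natrD => nz1 nz2 nz3.
  by field; rewrite ?nz1 ?nz2 ?nz3.
(* At [K = n.+2] the certificate contains the factor ['C(n.+1, n.+2) = 0], which leaves the
   recurrence. *)
have /esym := sumr n.+2; rewrite /B /beta_term bin_small // expr0n mul0r mulr0.
rewrite /r !sumrB -!mulr_sumr -!(betaE n.+3) ?ltnS ?leqW // => /esym/eqP.
by rewrite subr_eq0 subr_eq => /eqP ->; ring.
Qed.

(** In the inductive step the recurrence removes [beta n.+2] and a polynomial identity in [n]
    remains. The next two sums are treated in the same way. *)
Lemma sum_beta_plus n :
  \sum_(0 <= k < n.+1) (11 * k%:R ^+ 2 + 13 * k%:R + 4) * (beta k)%:R =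
  n.+1%:R ^+ 2 * ((beta n.+1)%:R + (beta n)%:R) :> rat.
Proof.
elim: n => [|n IH].
  by rewrite big_nat1 /beta !big_nat_recr //= !big_geq.
rewrite big_nat_recr //= IH [RHS]mulrDr beta_rec -!natr1; ring.
Qed.

Lemma sum_beta_alt n :
  \sum_(0 <= k < n.+1)
    (11 * k%:R ^+ 2 + 9 * k%:R + 2) * (-1) ^+ k * (beta k)%:R =
  (-1) ^+ n * n.+1%:R ^+ 2 * ((beta n.+1)%:R - (beta n)%:R) :> rat.
Proof.
elim: n => [|n IH].
  by rewrite big_nat1 /beta !big_nat_recr //= !big_geq.
rewrite big_nat_recr //= IH [RHS]mulrBr -[X in _ = X - _]mulrA beta_rec.
rewrite (exprS (-1)) -!natr1; ring.
Qed.

Lemma sum_beta_alt_cube n :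
  \sum_(0 <= k < n.+1)
    (11 * k%:R ^+ 3 + 7 * k%:R ^+ 2 - 1) * (-1) ^+ k * (beta k)%:R =
  (-1) ^+ n * (n.+1%:R ^+ 3 * ((beta n.+1)%:R - (beta n)%:R)
    - n.+1%:R ^+ 2 * (beta n.+1)%:R) :> rat.
Proof.
elim: n => [|n IH].
  by rewrite big_nat1 /beta !big_nat_recr //= !big_geq.
have h := beta_rec n.
rewrite big_nat_recr //= IH (exprS (-1)).
(* The value at [n.+2] is collected with the factor [n.+2 ^ 2], the form in which the recurrence
   supplies it. *)
have -> : n.+2%:R ^+ 3 * ((beta n.+2)%:R - (beta n.+1)%:R)
    - n.+2%:R ^+ 2 * (beta n.+2)%:R = (n.+2%:R - 1) * (n.+2%:R ^+ 2 * (beta n.+2)%:R)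
    - n.+2%:R ^+ 3 * (beta n.+1)%:R :> rat by ring.
rewrite beta_rec -!natr1; ring.
Qed.

(** This is the d-th finite difference of x -> binomial(x, d + r): by Pascal's rule each difference
    lowers the bottom index by one. *)
Lemma alternating_sum_bin d x r :
  \sum_(0 <= i < d.+1) (-1) ^+ (d + i) * 'C(d, i)%:R * 'C(x + i, d + r)%:R =
  'C(x, r)%:R :> rat.
Proof.
elim: d x r => [|d IH] x r.
  by rewrite big_nat1 !addn0 add0n bin0 expr0 !mul1r.
pose f y i : rat := (-1) ^+ (d + i) * 'C(d, i)%:R * 'C(y + i, (d + r).+1)%:R.
have fE y : \sum_(0 <= i < d.+1) f y i = 'C(y, r.+1)%:R.
  by rewrite -(IH y r.+1) addnS.
have -> : 'C(x, r)%:R = 'C(x.+1, r.+1)%:R - 'C(x, r.+1)%:R :> rat.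
  by rewrite binS natrD addrC addKr.
(* Pascal's rule on ['C(d.+1, i)] splits the sum into [f x.+1], with its index shifted by one, and
   [g]. *)
pose g i : rat := (-1) ^+ (d.+1 + i) * 'C(d, i)%:R * 'C(x + i, (d + r).+1)%:R.
have gE : \sum_(0 <= i < d.+1) g i = - 'C(x, r.+1)%:R.
  by rewrite -fE -sumrN; apply: eq_bigr => i _; rewrite /g /f addSn exprS; ring.
have : \sum_(0 <= i < d.+2) g i = - 'C(x, r.+1)%:R.
  by rewrite big_nat_recr //= gE {1}/g (@bin_small d d.+1) // mulr0 mul0r addr0.
rewrite big_nat_recl // => <-; rewrite [in LHS]big_nat_recl //.
rewrite addrCA -(fE x.+1) -big_split /=; congr (_ + _).
  by rewrite /g !bin0 addSn.
apply: eq_bigr => i _; rewrite /f /g binS natrD addSn !addnS addSn !exprS.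
by ring.
Qed.

(** Both sides equal n! / (i! j! (n - i - j)!). *)
Lemma bin_trinomial n i j : (i + j <= n)%N ->
  ('C(n, i + j) * 'C(i + j, j) = 'C(n, j) * 'C(n - j, i))%N.
Proof.
move=> le_ijn; have le_jn : (j <= n)%N by lia.
have le_inj : (i <= n - j)%N by lia.
have h1 := bin_fact le_ijn; have h2 := bin_fact (leq_addl i j).
have h3 := bin_fact le_jn; have h4 := bin_fact le_inj.
have e : (n - (i + j) = n - j - i)%N by lia.
rewrite addnK in h2; rewrite e -h2 in h1; rewrite -h4 -h1 in h3.
have f_gt0 : (0 < j`! * i`! * (n - j - i)`!)%N by rewrite !muln_gt0 !fact_gt0.
by apply/eqP; rewrite -(eqn_pmul2r f_gt0); apply/eqP; lia.
Qed.

(** One factor binomial(n + k, k) is expanded by Vandermonde as the sum of binomial(n, j)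
    binomial(k, j). After exchanging the sums, the sum over k is a finite difference of order n - j,
    equal to binomial(n + j, j). *)
Lemma beta_altE n :
  (beta n)%:R =
  \sum_(0 <= k < n.+1) (-1) ^+ (n + k) * 'C(n, k)%:R * 'C(n + k, k)%:R ^+ 2 :> rat.
Proof.
pose t k j : rat := (-1) ^+ (n + k) * 'C(n, k)%:R * 'C(n + k, k)%:R
   * ('C(n, j)%:R * 'C(k, j)%:R).
transitivity (\sum_(0 <= k < n.+1) \sum_(0 <= j < n.+1) t k j); last first.
  apply: eq_bigr => k _; rewrite -mulr_sumr expr2 mulrA; congr (_ * _).
  have -> : 'C(n + k, k) = 'C(k + n, n).
    by rewrite -(@bin_sub (k + n) n) ?leq_addl // addnK addnC.
  rewrite -binomial.Vandermonde natr_sum big_mkord.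
  apply: eq_bigr => j _; rewrite natrM mulrC bin_sub // -ltnS //.
rewrite exchange_big_nat /= (betaE n.+1) //; apply: eq_big_nat => j /andP[_ lt_jn].
have le_jn : (j <= n)%N by [].
rewrite (big_cat_nat (leq0n j)) /=; last exact: leqW.
rewrite big_nat big1 ?add0r => [|k /andP[_ lt_kj]]; last first.
  by rewrite /t (@bin_small k j) // !mulr0.
have -> : \sum_(j <= k < n.+1) t k j = \sum_(0 <= i < (n - j).+1) t (i + j)%N j.
  by rewrite -{1}(add0n j) big_addn subSn.
rewrite /beta_term expr2 -mulrA.
have := alternating_sum_bin (n - j) (n + j) j.
rewrite subnK // => <-; rewrite mulr_sumr mulr_sumr; apply: eq_big_nat => i /andP[_ lt_i].
have le_in : (i <= n - j)%N by [].
have -> : (-1) ^+ (n - j + i) = (-1) ^+ (n + (i + j)) :> rat.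
  by rewrite -signr_odd -[in RHS]signr_odd; congr (_ ^+ _); congr (nat_of_bool _); lia.
have tri : 'C(n, i + j)%:R * 'C(i + j, j)%:R = 'C(n, j)%:R * 'C(n - j, i)%:R :> rat.
  rewrite -!natrM; congr _%:R.
  have ? : (i + j <= n)%N by lia.
  exact: bin_trinomial.
have -> : 'C(n + j + i, n) = 'C(n + (i + j), i + j).
  by rewrite -addnA (addnC j i) -(@bin_sub (n + (i + j)) n) ?leq_addr // addKn.
transitivity ((-1) ^+ (n + (i + j)) * 'C(n + (i + j), i + j)%:R *
  ('C(n, i + j)%:R * 'C(i + j, j)%:R) * 'C(n, j)%:R :> rat).
  by rewrite tri; ring.
by rewrite /t; ring.
Qed.

(** * The products W(x, j) and two linear combinations of values of beta *)

Definition beta_prod (x : rat) (j : nat) : rat :=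
  \prod_(1 <= i < j) ((1 - x / i%:R) ^+ 2 * (1 + x / i%:R)).

Lemma beta_prod1 x : beta_prod x 1 = 1.
Proof. by rewrite /beta_prod big_geq. Qed.

Lemma beta_prodS x k :
  beta_prod x k.+2 =
  beta_prod x k.+1 * ((1 - x / k.+1%:R) ^+ 2 * (1 + x / k.+1%:R)).
Proof. by rewrite /beta_prod big_nat_recr. Qed.

(** For x = m + 1 the factors 1 - x/i build binomial(m, k) up to sign and the factors 1 + x/i build
    binomial(m + 1 + k, k). For x = -(m + 1) the two roles are exchanged. So W matches the terms of
    one or the other expression of [beta]. *)
Lemma beta_prod_bin m k :
  beta_prod m.+1%:R k.+1 = 'C(m, k)%:R ^+ 2 * 'C(m.+1 + k, k)%:R.
Proof.
elim: k => [|k IH]; first by rewrite beta_prod1 !bin0 !mul1r.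
rewrite beta_prodS IH (natr_bin_left m k) addnS natr_bin_diag.
have := natrS_neq0 k; rewrite !addSn -!natr1 !natrD => nz.
by field.
Qed.

Lemma beta_prodN_bin m k :
  beta_prod (- m.+1%:R) k.+1 =
  (-1) ^+ k * 'C(m, k)%:R * 'C(m.+1 + k, k)%:R ^+ 2.
Proof.
elim: k => [|k IH]; first by rewrite beta_prod1 !bin0 !mul1r.
rewrite beta_prodS IH (natr_bin_left m k) addnS natr_bin_diag (exprS (-1)).
have := natrS_neq0 k; rewrite !addSn -!natr1 !natrD => nz.
by field.
Qed.

(* Telescoping: [W (j + 1) - W j = W j * (y ^+ 3 - y ^+ 2 - y)] for
   [W = beta_prod n] and [y = n / j]. *)
Lemma beta_combination_pos m :
  3 * (beta m.+1)%:R + (beta m)%:R =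
  5 + 5 * \sum_(0 <= k < m.+1) beta_prod m.+1%:R k.+1 * (m.+1%:R / k.+1%:R) ^+ 3
  :> rat.
Proof.
have nzm := natrS_neq0 m.
have tele : \sum_(0 <= k < m.+1)
    (beta_prod m.+1%:R k.+2 - beta_prod m.+1%:R k.+1) = - 1.
  by rewrite telescope_sumr // beta_prod1 beta_prod_bin bin_small // expr0n mul0r sub0r.
rewrite (betaE m.+2) // (betaE m.+2 m) // !(big_nat_recl m.+1) //.
rewrite {1 3}/beta_term !bin0 expr1n mulr1.
suff -> : 5 * \sum_(0 <= k < m.+1) beta_prod m.+1%:R k.+1 * (m.+1%:R / k.+1%:R) ^+ 3
  = 3 * \sum_(0 <= k < m.+1) beta_term m.+1 k.+1
    + \sum_(0 <= k < m.+1) beta_term m k.+1 - 1 by ring.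
(* With y = (m + 1)/(k + 1), the terms divided by W are 3 y^2 (1 + y), y (y - 1)^2 and y^3 - y^2 -
   y, with sum 5 y^3. *)
rewrite -tele !mulr_sumr -!big_split /=; apply: eq_bigr => k _.
rewrite beta_prodS beta_prod_bin /beta_term natr_bin_diag (natr_bin_left m k).
rewrite (addnS m.+1) natr_bin_diag addnS -addSn (natr_bin_left (m.+1 + k) k).
have nzk := natrS_neq0 k; move: nzk nzm; rewrite !addSn -!natr1 !natrD => nzk nzm.
by field.
Qed.

(** The counterpart at x = -(m + 1), based on the alternating expression of [beta]. An even [m]
    fixes the signs in front of the two sums; the application is m = p - 1. *)
Lemma beta_combination_neg m : ~~ odd m ->
  (beta m.+1)%:R - 3 * (beta m)%:R =
  - 5 + 5 * \sum_(0 <= k < m.+1)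
              beta_prod (- m.+1%:R) k.+1 * (m.+1%:R / k.+1%:R) ^+ 3
  :> rat.
Proof.
move=> ev_m; have nzm := natrS_neq0 m.
have sm : (-1) ^+ m = 1 :> rat by rewrite -signr_odd (negbTE ev_m).
have tele : \sum_(0 <= k < m.+1)
    (beta_prod (- m.+1%:R) k.+2 - beta_prod (- m.+1%:R) k.+1) = - 1.
  by rewrite telescope_sumr // beta_prod1 beta_prodN_bin bin_small // mulr0 mul0r sub0r.
pose a n k : rat := (-1) ^+ k * 'C(n, k)%:R * 'C(n + k, k)%:R ^+ 2.
have b1 : (beta m.+1)%:R = - (1 + \sum_(0 <= k < m.+1) a m.+1 k.+1) :> rat.
  rewrite beta_altE big_nat_recl // /a opprD -sumrN !bin0 addn0 (exprS (-1)) sm; congr (_ + _).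
  by apply: eq_bigr => k _; rewrite exprD (exprS (-1) m) sm; ring.
have b0 : (beta m)%:R = 1 + \sum_(0 <= k < m.+1) a m k.+1 :> rat.
  rewrite beta_altE [in RHS]big_nat_recr //= {2}/a bin_small // mulr0 mul0r addr0.
  rewrite big_nat_recl // !bin0 addn0 sm; congr (_ + _).
  by apply: eq_bigr => k _; rewrite exprD sm mul1r.
rewrite b1 b0.
suff -> : 5 * \sum_(0 <= k < m.+1)
    beta_prod (- m.+1%:R) k.+1 * (m.+1%:R / k.+1%:R) ^+ 3
  = - \sum_(0 <= k < m.+1) a m.+1 k.+1
    - 3 * \sum_(0 <= k < m.+1) a m k.+1 + 1 by ring.
(* With y as before, the terms divided by W are y (1 + y)^2, 3 y^2 (y - 1) and y^3 + y^2 - y, again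
   with sum 5 y^3. *)
rewrite -[X in _ + X]opprK -tele !mulr_sumr -!sumrN -!big_split /=; apply: eq_bigr => k _.
rewrite beta_prodS beta_prodN_bin /a natr_bin_diag (natr_bin_left m k).
rewrite (addnS m.+1) natr_bin_diag addnS -addSn (natr_bin_left (m.+1 + k) k) (exprS (-1)).
have nzk := natrS_neq0 k; move: nzk nzm; rewrite !addSn -!natr1 !natrD => nzk nzm.
by field.
Qed.

(** * Faulhaber's formula *)

Lemma bin_trinomialC n i j : (i + j <= n)%N ->
  ('C(n, j) * 'C(n - j, i) = 'C(n, i) * 'C(n - i, j))%N.
Proof.
move=> le; have le' : (j + i <= n)%N by rewrite addnC.
rewrite -(bin_trinomial _ _ _ le) -(bin_trinomial _ _ _ le') (addnC j i).
by rewrite -(bin_sub (leq_addl i j)) addnK.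
Qed.

(** Induction on n. In the increment of the right side the coefficient of n^l is binomial(m + 1, l)
    times the sum of binomial(m + 1 - l, k) B_k over k < m + 1 - l, which the defining relation
    kills unless l = m. *)
Lemma faulhaber m n :
  m.+1%:R * \sum_(0 <= i < n) i%:R ^+ m =
  \sum_(0 <= k < m.+1) 'C(m.+1, k)%:R * bernoulli k * n%:R ^+ (m.+1 - k).
Proof.
elim: n => [|n IH].
  rewrite big_geq // mulr0 big_nat big1 // => k /andP[_ lt_km].
  by rewrite expr0n subn_eq0 leqNgt lt_km mulr0.
rewrite big_nat_recr //= mulrDr {}IH.
apply/esym/eqP; rewrite addrC -subr_eq -sumrB; apply/eqP.
(* Cutting [t] off at [k + l < m.+1] lets both orders of summation run over the same square. *)
pose t k l : rat := if (k + l < m.+1)%N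
  then 'C(m.+1, l)%:R * n%:R ^+ l * ('C(m.+1 - l, k)%:R * bernoulli k) else 0.
transitivity (\sum_(0 <= k < m.+1) \sum_(0 <= l < m.+1) t k l).
  apply: eq_big_nat => k /andP[_ lt_km].
  have e : (m.+1 - k <= m.+1)%N by rewrite leq_subr.
  have z : \sum_(m.+1 - k <= l < m.+1) t k l = 0.
    by rewrite big_nat big1 // => l /andP[h _]; rewrite /t ifF //; lia.
  rewrite (big_cat_nat (leq0n _) e) /= z addr0 -mulrBr -natr1 exprD1n.
  rewrite -(big_mkord xpredT (fun i => n%:R ^+ i *+ 'C(m.+1 - k, i))).
  rewrite big_nat_recr //= binn addrK mulr_sumr; apply: eq_big_nat => l /andP[_ lt_l].
  have h : (k + l < m.+1)%N by lia.
  have h' : (l + k <= m.+1)%N by lia.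
  rewrite /t h -mulr_natr.
  transitivity (('C(m.+1, k) * 'C(m.+1 - k, l))%N%:R * bernoulli k * n%:R ^+ l).
    by rewrite natrM; ring.
  by rewrite bin_trinomialC // natrM; ring.
rewrite exchange_big_nat /= big_nat_recr //= big_nat big1 ?add0r => [|l /andP[_ lt_lm]].
  rewrite big_nat_recl // big_nat big1 ?addr0 => [|k _]; last by rewrite /t ifF //; lia.
  by rewrite /t add0n ltnSn bernoulli0 bin0 binSn !mulr1.
have e : (m.+1 - l <= m.+1)%N by rewrite leq_subr.
have z : \sum_(m.+1 - l <= k < m.+1) t k l = 0.
  by rewrite big_nat big1 // => k /andP[h _]; rewrite /t ifF //; lia.
rewrite (big_cat_nat (leq0n _) e) /= z addr0.
transitivity ('C(m.+1, l)%:R * n%:R ^+ l *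
   \sum_(0 <= k < m.+1 - l) 'C(m.+1 - l, k)%:R * bernoulli k).
  rewrite mulr_sumr; apply: eq_big_nat => k /andP[_ lt_k].
  by rewrite /t ifT //; lia.
by rewrite subSn 1?ltnW // bernoulli_sum ?mulr0 // subn_gt0.
Qed.

(** Named so that p = 5 and p > 5 can be treated separately. *)
Definition beta_sum_congruences (p : nat) : Prop :=
  [/\ eqmod_pow p 8
        (\sum_(0 <= k < p)
           (11 * k%:R ^+ 2 + 13 * k%:R + 4) * (beta k)%:R)
        (4 * p%:R ^+ 2 + 4 * p%:R ^+ 7 * bernoulli (p - 5)),
      eqmod_pow p 8
        (\sum_(0 <= k < p)
           (11 * k%:R ^+ 2 + 9 * k%:R + 2) * (-1) ^+ k * (beta k)%:R)
        (2 * p%:R ^+ 2 + 10 * p%:R ^+ 3 * harmonic p.-1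
           - p%:R ^+ 7 * bernoulli (p - 5))
    & eqmod_pow p 8
        (\sum_(0 <= k < p)
           (11 * k%:R ^+ 3 + 7 * k%:R ^+ 2 - 1) * (-1) ^+ k * (beta k)%:R)
        (2 * p%:R ^+ 3 - 3 * p%:R ^+ 2
           + (10 * p%:R - 5) * p%:R ^+ 3 * harmonic p.-1
           - 3 / 2 * p%:R ^+ 7 * bernoulli (p - 5))].

(** * Congruences between p-integral rationals *)

Set Implicit Arguments.
Unset Strict Implicit.

Section PAdic.

Variable p : nat.
Hypothesis p_prime : prime p.

(** Any fraction for x will do, reduced or not, since [denq x] divides each denominator. Closure
    under sums and products then follows by multiplying denominators. *)
Lemma p_integralP (x : rat) :
  reflect (exists m : int, exists2 d : nat, coprime p d & x * d%:R = m%:~R)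
          (p_integral p x).
Proof.
apply: (iffP idP) => [cpx | [m [d cpd xd]]].
  by exists (numq x), `|denq x|%N => //; rewrite pmulrn absz_denq numqE.
have eq_nd : numq x * d%:Z = m * denq x.
  apply: (@intr_inj rat); rewrite !rmorphM /= -xd numqE.
  by rewrite -pmulrn; ring.
have : (`|denq x| %| `|numq x| * d)%N.
  by rewrite -[d]/(`|d%:Z|)%N -abszM eq_nd abszM dvdn_mull.
rewrite Gauss_dvdr; last by rewrite coprime_sym coprime_num_den.
by move=> ?; apply: coprime_dvdr cpd.
Qed.

Lemma p_integral_nat n : p_integral p n%:R.
Proof.
by apply/p_integralP; exists n%:Z, 1%N; rewrite ?coprimen1 // mulr1 pmulrn.
Qed.

Lemma p_integralD x y : p_integral p x -> p_integral p y -> p_integral p (x + y).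
Proof.
move=> /p_integralP[m [d cd ed]] /p_integralP[n [e ce ee]]; apply/p_integralP.
exists (m * e%:Z + n * d%:Z), (d * e)%N; first by rewrite coprimeMr cd.
by rewrite intrD !intrM -ed -ee -!pmulrn natrM; ring.
Qed.

Lemma p_integralM x y : p_integral p x -> p_integral p y -> p_integral p (x * y).
Proof.
move=> /p_integralP[m [d cd ed]] /p_integralP[n [e ce ee]]; apply/p_integralP.
exists (m * n), (d * e)%N; first by rewrite coprimeMr cd.
by rewrite intrM -ed -ee natrM; ring.
Qed.

Lemma p_integral_sum (I : Type) (r : seq I) (P : pred I) (F : I -> rat) :
  (forall i, P i -> p_integral p (F i)) -> p_integral p (\sum_(i <- r | P i) F i).
Proof.
move=> PF; elim/big_ind: _ => //; [exact: (p_integral_nat 0) | exact: p_integralD].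
Qed.

Lemma p_integralX x n : p_integral p x -> p_integral p (x ^+ n).
Proof.
move=> px; elim: n => [|n IH]; first exact: (p_integral_nat 1).
by rewrite exprS p_integralM.
Qed.

Lemma p_integral_inv n : coprime p n -> p_integral p n%:R^-1.
Proof.
move=> cpn; apply/p_integralP; exists 1, n => //; rewrite mulVf //.
rewrite pnatr_eq0; apply: contraTneq cpn => ->.
by rewrite /coprime gcdn0 neq_ltn prime_gt1 ?orbT.
Qed.

Lemma coprime_lt_prime n : (0 < n < p)%N -> coprime p n.
Proof.
by case/andP=> n0 np; rewrite prime_coprime // gtnNdvd.
Qed.

(** * Divisibility by powers of p *)

Let p_neq0 : p%:R != 0 :> rat.
Proof. by rewrite pnatr_eq0 -lt0n prime_gt0. Qed.

(** The ideal generated by p^n in the p-integral rationals. The notation [O n x] is meant to read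
    like an error term of order p^n. *)
Definition pow_dvd (n : nat) (x : rat) : bool := p_integral p (x / p%:R ^+ n).
Local Notation O := pow_dvd.

Lemma pow_dvd0E x : O 0 x = p_integral p x.
Proof. by rewrite /pow_dvd expr0 divr1. Qed.

Lemma pow_dvdP n x : reflect (exists2 c, p_integral p c & x = p%:R ^+ n * c) (O n x).
Proof.
apply: (iffP idP) => [h | [c hc ->]].
  by exists (x / p%:R ^+ n) => //; rewrite mulrC divfK // expf_neq0.
by rewrite /pow_dvd mulrAC mulfV ?mul1r ?expf_neq0.
Qed.

Lemma pow_dvdD n x y : O n x -> O n y -> O n (x + y).
Proof. by rewrite /pow_dvd mulrDl; apply: p_integralD. Qed.

Lemma pow_dvdN n x : O n (- x) = O n x.
Proof. by rewrite /pow_dvd mulNr /p_integral denqN. Qed.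

Lemma pow_dvdB n x y : O n x -> O n y -> O n (x - y).
Proof. by move=> hx hy; rewrite pow_dvdD ?pow_dvdN. Qed.

Lemma pow_dvdM m n x y : O m x -> O n y -> O (m + n) (x * y).
Proof.
by rewrite /pow_dvd exprD invfM mulrACA; apply: p_integralM.
Qed.

Lemma pow_dvdMl n x y : O 0 x -> O n y -> O n (x * y).
Proof. exact: (@pow_dvdM 0). Qed.

Lemma pow_dvdMr n x y : O n x -> O 0 y -> O n (x * y).
Proof. by move=> hx hy; rewrite mulrC pow_dvdMl. Qed.

Lemma pow_dvd_p n : O n (p%:R ^+ n).
Proof. by rewrite /pow_dvd mulfV ?expf_neq0 // (p_integral_nat 1). Qed.

Lemma pow_dvd_pM m n x : O (m + n) (p%:R ^+ m * x) = O n x.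
Proof.
by rewrite /pow_dvd exprD invfM mulrACA mulfV ?expf_neq0 ?mul1r.
Qed.

Lemma pow_dvd_leq m n x : (m <= n)%N -> O n x -> O m x.
Proof.
move=> le_mn /pow_dvdP[c ic ->]; rewrite -(subnKC le_mn) exprD -mulrA.
rewrite -[X in O X]addn0 pow_dvd_pM pow_dvd0E p_integralM //.
by rewrite p_integralX ?p_integral_nat.
Qed.

Lemma pow_dvd_sum n (I : Type) (r : seq I) (P : pred I) (F : I -> rat) :
  (forall i, P i -> O n (F i)) -> O n (\sum_(i <- r | P i) F i).
Proof. by move=> PF; rewrite /pow_dvd mulr_suml; apply: p_integral_sum. Qed.

Lemma pow_dvd_sum_nat n a b (F : nat -> rat) :
  (forall i, (a <= i < b)%N -> O n (F i)) -> O n (\sum_(a <= i < b) F i).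
Proof. by move=> PF; rewrite big_nat pow_dvd_sum. Qed.

Lemma pow_dvd_zero n : O n 0.
Proof. by rewrite /pow_dvd mul0r (p_integral_nat 0). Qed.

Lemma pow_dvd_nat n : O 0 n%:R.
Proof. by rewrite pow_dvd0E p_integral_nat. Qed.

Lemma pow_dvdX n x : O 0 x -> O 0 (x ^+ n).
Proof. by rewrite !pow_dvd0E; apply: p_integralX. Qed.

Lemma pow_dvd_inv i : (0 < i < p)%N -> O 0 i%:R^-1.
Proof. by move=> ?; rewrite pow_dvd0E p_integral_inv ?coprime_lt_prime. Qed.

Lemma pow_dvd_inv_coprime i : coprime p i -> O 0 i%:R^-1.
Proof. by move=> ?; rewrite pow_dvd0E p_integral_inv. Qed.

Lemma pow_dvd_eqmod n x y : p_integral p y -> O n (x - y) -> eqmod_pow p n x y.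
Proof.
move=> iy /pow_dvdP[c ic e]; split=> //; last by exists c.
rewrite -[x](subrK y) e p_integralD // p_integralM // p_integralX //.
exact: p_integral_nat.
Qed.

Lemma pow_dvd1 : O 0 1.
Proof. exact: (pow_dvd_nat 1). Qed.

Lemma pow_dvd_mulp n x : O 0 x -> O n (p%:R ^+ n * x).
Proof. by rewrite -{1}(addn0 n) pow_dvd_pM. Qed.

Lemma pow_dvd_unit n k x : coprime p k -> O n (k%:R * x) -> O n x.
Proof.
move=> cpk h; have nz : k%:R != 0 :> rat.
  rewrite pnatr_eq0; apply: contraTneq cpk => ->.
  by rewrite /coprime gcdn0 neq_ltn prime_gt1 ?orbT.
by rewrite -(mulKf nz x) pow_dvdMl // pow_dvd_inv_coprime.
Qed.

Lemma pow_dvd_dvdn n : (p %| n)%N -> O 1 n%:R.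
Proof.
case/dvdnP=> k ->; rewrite natrM mulrC -[p%:R]expr1.
by rewrite pow_dvd_mulp // pow_dvd_nat.
Qed.

(** * Power sums and Bernoulli numbers *)

(** The recursion up to index n divides only by integers at most n + 1, all prime to p. *)
Lemma bernoulli_pow_dvd n : (n.+1 < p)%N -> O 0 (bernoulli n).
Proof.
elim/ltn_ind: n => n IH lt_np; have [->|n_gt0] := posnP n; first exact: pow_dvd1.
rewrite bernoulliE // pow_dvdMr ?pow_dvd_inv // pow_dvdN.
apply: pow_dvd_sum_nat => k /andP[_ lt_kn].
by rewrite pow_dvdMl ?pow_dvd_nat // IH //; lia.
Qed.

(** In Faulhaber's formula the last term is (m + 1) p B_m, every other term carries p^2, and m + 1
    is a unit. *)
Lemma power_sum_bernoulli m : (m.+1 < p)%N ->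
  O 2 (\sum_(0 <= i < p) i%:R ^+ m - p%:R * bernoulli m).
Proof.
move=> lt_mp; apply: (@pow_dvd_unit _ m.+1); first by rewrite coprime_lt_prime.
rewrite mulrBr faulhaber big_nat_recr //= subSnn binSn.
rewrite (_ : _ + _ - _ = \sum_(0 <= k < m)
   'C(m.+1, k)%:R * bernoulli k * p%:R ^+ (m.+1 - k)); last by ring.
apply: pow_dvd_sum_nat => k /andP[_ lt_km].
rewrite pow_dvdMl //; first by rewrite pow_dvdMl ?pow_dvd_nat ?bernoulli_pow_dvd //; lia.
by apply: (@pow_dvd_leq _ (m.+1 - k)); rewrite ?pow_dvd_p //; lia.
Qed.

Lemma power_sum_pow_dvd m : (0 < m)%N -> (m.+1 < p)%N ->
  O 1 (\sum_(1 <= i < p) i%:R ^+ m).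
Proof.
move=> m_gt0 lt_mp; have := power_sum_bernoulli lt_mp.
rewrite big_ltn ?prime_gt0 // expr0n gtn_eqF // add0r => /(@pow_dvd_leq 1 2 _ isT).
move/pow_dvdD => /(_ (p%:R * bernoulli m)); rewrite subrK; apply.
by rewrite -[p%:R]expr1 pow_dvd_mulp ?bernoulli_pow_dvd.
Qed.

Lemma fermat_pow_dvd i : (0 < i < p)%N -> O 1 (i%:R ^+ p.-1 - 1).
Proof.
move=> hi; have i_gt0 : (0 < i)%N by case/andP: hi.
have -> : i%:R ^+ p.-1 - 1 = (i ^ p.-1 - 1)%N%:R :> rat.
  by rewrite natrB ?natrX // expn_gt0 i_gt0.
apply: pow_dvd_dvdn.
rewrite -eqn_mod_dvd ?expn_gt0 ?i_gt0 // -totient_prime //.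
by apply/eqP/Euler_exp_totient; rewrite coprime_sym coprime_lt_prime.
Qed.

Lemma inverse_power_fermat i k : (0 < i < p)%N -> (k <= p.-1)%N ->
  O 1 (i%:R ^- k - i%:R ^+ (p.-1 - k)).
Proof.
move=> hi hk; have nz : i%:R != 0 :> rat by rewrite pnatr_eq0; lia.
have -> : i%:R ^- k - i%:R ^+ (p.-1 - k) = - (i%:R ^+ p.-1 - 1) * i%:R ^-1 ^+ k :> rat.
  by rewrite -{2}(subnK hk) exprD exprVn mulNr mulrBl mul1r mulfK ?expf_neq0 // opprB.
by rewrite pow_dvdMr ?pow_dvdN ?fermat_pow_dvd // pow_dvdX // pow_dvd_inv.
Qed.

Lemma pow_dvd_sub n y x : O n (x - y) -> O n y -> O n x.
Proof. by move=> hxy hy; rewrite -(subrK y x) pow_dvdD. Qed.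

Lemma inverse_power_sum_pow_dvd (k : nat) : (0 < k)%N -> (k < p.-1)%N ->
  O 1 (\sum_(1 <= i < p) i%:R ^- k).
Proof.
move=> k_gt0 lt_kp; apply: (@pow_dvd_sub _ (\sum_(1 <= i < p) i%:R ^+ (p.-1 - k))).
  rewrite -sumrB; apply: pow_dvd_sum_nat => i hi.
  by apply: inverse_power_fermat => //; lia.
by apply: power_sum_pow_dvd; lia.
Qed.

(** By Fermat i^-a becomes i^(p - 1 - a), and Faulhaber's formula makes the inner sum a polynomial
    in j. Summed over j against j^-b, only the exponent 0 survives modulo p; the factor p - a is the
    one in Faulhaber's formula. *)
Lemma double_sum_bernoulli a b : (0 < a)%N -> (0 < b)%N -> (a + b < p.-1)%N ->
  O 1 ((p%:R - a%:R) * \sum_(1 <= j < p) (\sum_(1 <= i < j) i%:R ^- a) * j%:R ^- b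
       - (p%:R - 1) * 'C(p - a, b)%:R * bernoulli (p - (a + b))).
Proof.
move=> a_gt0 b_gt0 lt_abp; pose m := (p.-1 - a)%N.
have m1 : m.+1%:R = p%:R - a%:R :> rat by rewrite -natrB; [congr _%:R|]; rewrite /m; lia.
pose t j k : rat := 'C(m.+1, k)%:R * bernoulli k * (j%:R ^+ (m.+1 - k) * j%:R ^- b).
apply: (@pow_dvd_sub _ (\sum_(1 <= j < p) \sum_(0 <= k < m.+1) t j k
   - (p%:R - 1) * 'C(p - a, b)%:R * bernoulli (p - (a + b)))).
  rewrite opprB addrA subrK mulr_sumr -sumrB; apply: pow_dvd_sum_nat => j hj.
  have -> : \sum_(0 <= k < m.+1) t j k =
      m.+1%:R * (\sum_(1 <= i < j) i%:R ^+ m) * j%:R ^- b.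
    transitivity (m.+1%:R * (\sum_(0 <= i < j) i%:R ^+ m) * j%:R ^- b : rat).
      by rewrite faulhaber mulr_suml; apply: eq_bigr => k _; rewrite /t; ring.
    congr (_ * _ * _); rewrite big_ltn; last by lia.
    by rewrite expr0n gtn_eqF ?add0r // /m; lia.
  rewrite m1 mulrA -mulrBl -mulrBr -sumrB pow_dvdMr //; last first.
    by rewrite -exprVn pow_dvdX // pow_dvd_inv.
  rewrite pow_dvdMl ?pow_dvdB ?pow_dvd_nat //.
  by apply: pow_dvd_sum_nat => i hi; apply: inverse_power_fermat; lia.
rewrite exchange_big_nat /=.
(* Here [m.+1 = p - a], so the exponent [m.+1 - k - b] of j is 0 exactly at [k = p - (a + b)]. *)
have hk0 : (p - (a + b) < m.+1)%N by rewrite /m; lia.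
rewrite big_mkord (bigD1 (Ordinal hk0)) //=.
have -> : \sum_(1 <= j < p) t j (p - (a + b))%N =
    (p%:R - 1) * 'C(p - a, b)%:R * bernoulli (p - (a + b)).
  transitivity (\sum_(1 <= j < p) 'C(p - a, b)%:R * bernoulli (p - (a + b))).
    apply: eq_big_nat => j hj; have nz : j%:R != 0 :> rat by rewrite pnatr_eq0; lia.
    have e1 : (m.+1 - (p - (a + b)) = b)%N by rewrite /m; lia.
    have e2 : (p - (a + b) = m.+1 - b)%N by rewrite /m; lia.
    have e3 : (p - a = m.+1)%N by rewrite /m; lia.
    rewrite /t e1 mulfV ?expf_neq0 // mulr1 {1}e2 e3 bin_sub // /m; lia.
  by rewrite sumr_const_nat -[_ *+ (p - 1)]mulr_natl natrB ?prime_gt0 // mulrA.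
rewrite addrAC subrr add0r; apply: pow_dvd_sum => k nk.
have nk' : (nat_of_ord k != p - (a + b))%N by apply: contraNneq nk => e; apply/eqP/val_inj.
have hk := ltn_ord k; rewrite -mulr_sumr pow_dvdMl //.
  by rewrite pow_dvdMl ?pow_dvd_nat ?bernoulli_pow_dvd //; move: hk; rewrite /m; lia.
(* The remaining exponents are nonzero and of absolute value below p - 1, so their power sums vanish
   modulo p. *)
have [lt|ge] := ltnP b (m.+1 - k).
  rewrite (_ : \sum_(_ <= _ < _) _ = \sum_(1 <= j < p) j%:R ^+ (m.+1 - k - b)).
    by apply: power_sum_pow_dvd; move: hk nk' lt; rewrite /m; lia.
  apply: eq_big_nat => j hj; have nz : j%:R != 0 :> rat by rewrite pnatr_eq0; lia.
  by rewrite -{1}(subnK (ltnW lt)) exprD mulfK ?expf_neq0.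
rewrite (_ : \sum_(_ <= _ < _) _ = \sum_(1 <= j < p) j%:R ^- (b - (m.+1 - k))).
  by apply: inverse_power_sum_pow_dvd; move: hk nk' ge; rewrite /m; lia.
apply: eq_big_nat => j hj; have nz : j%:R != 0 :> rat by rewrite pnatr_eq0; lia.
by rewrite -{1}(subnK ge) exprD invfM mulrCA mulfV ?expf_neq0 ?mulr1.
Qed.

Ltac integral := repeat match goal with
  | H : is_true (pow_dvd 0 ?x) |- is_true (pow_dvd 0 ?x) => exact: H
  | |- is_true (pow_dvd 0 (_ + _)) => apply: pow_dvdD
  | |- is_true (pow_dvd 0 (- _)) => rewrite pow_dvdN
  | |- is_true (pow_dvd 0 (_ * _)) => apply: pow_dvdMl
  | |- is_true (pow_dvd 0 (_ ^+ _)) => apply: pow_dvdX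
  | |- is_true (pow_dvd 0 1) => exact: pow_dvd1
  | |- is_true (pow_dvd 0 _%:R) => exact: pow_dvd_nat
  | |- is_true (pow_dvd 0 _%:R^-1) =>
      first [by apply: pow_dvd_inv; lia | by apply: pow_dvd_inv_coprime]
  end.

(** * Harmonic sums *)

Lemma pow_dvd_first_order m x : O 0 x ->
  O 2 ((p%:R + x) ^+ m.+1 - x ^+ m.+1 - m.+1%:R * p%:R * x ^+ m).
Proof.
move=> ix; elim: m => [|m IH].
  by rewrite (_ : _ - _ = 0) ?pow_dvd_zero //; ring.
rewrite (_ : _ - _ = (p%:R + x) *
    ((p%:R + x) ^+ m.+1 - x ^+ m.+1 - m.+1%:R * p%:R * x ^+ m)
    + p%:R ^+ 2 * (m.+1%:R * x ^+ m)).
  by apply: pow_dvdD; [apply: pow_dvdMl; last exact: IH|apply: pow_dvd_mulp]; integral.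
rewrite !(exprS _ m.+1) (exprS x m) -(natr1 m.+1); ring.
Qed.

Lemma pow_dvd_subX n k x y : O 0 x -> O 0 y -> O n (x - y) -> O n (x ^+ k - y ^+ k).
Proof.
move=> ix iy h; elim: k => [|k IH]; first by rewrite subrr pow_dvd_zero.
rewrite (_ : _ - _ = x * (x ^+ k - y ^+ k) + y ^+ k * (x - y)); last by rewrite !exprS; ring.
by apply: pow_dvdD; apply: pow_dvdMl => //; integral.
Qed.

Lemma sum_nat_rev (f : nat -> rat) :
  \sum_(1 <= j < p) f j = \sum_(1 <= j < p) f (p - j)%N.
Proof. by rewrite big_nat_rev /=; apply: eq_bigr => j _; congr f; lia. Qed.

(* Both sides list the residues [2 j] reduced modulo [2 h + 1]. *)
Lemma doubling_sum h (g : nat -> rat) :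
  \sum_(1 <= i < h.*2.+1) g i.*2 - \sum_(1 <= i < h.*2.+1) g i =
  \sum_(0 <= j < h) (g (h.*2.+1 + j.*2.+1)%N - g j.*2.+1).
Proof.
have odd_even : \sum_(1 <= i < h.*2.+1) g i =
    \sum_(0 <= j < h) g j.*2.+1 + \sum_(1 <= j < h.+1) g j.*2.
  elim: h => [|h IH]; first by rewrite !big_geq // addr0.
  rewrite doubleS !(big_nat_recr h.*2.+2) // (big_nat_recr h.*2.+1) // IH /=.
  rewrite (big_nat_recr h 0) // (big_nat_recr h.+1 1) //= doubleS; ring.
rewrite odd_even (@big_cat_nat _ _ _ h.+1 1 h.*2.+1) //=; last by lia.
have -> : \sum_(h.+1 <= i < h.*2.+1) g i.*2 =
    \sum_(0 <= j < h) g (h.*2.+1 + j.*2.+1)%N.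
  rewrite -[h.+1 in LHS]add0n big_addn (_ : (h.*2.+1 - h.+1 = h)%N); last by lia.
  by apply: eq_bigr => j _; congr g; lia.
by rewrite sumrB; ring.
Qed.

(** * The prime 5, by direct computation *)

Lemma beta_sum_congruences_5 : p = 5 -> beta_sum_congruences p.
Proof.
move=> p5; have cop k : ~~ (5 %| k)%N -> coprime p k by rewrite p5 prime_coprime.
have b0 : beta 0 = 1%N by rewrite /beta !big_nat_recr //= !big_geq.
have b1 : beta 1 = 3%N by rewrite /beta !big_nat_recr //= !big_geq.
have b2 : beta 2 = 19%N by rewrite /beta !big_nat_recr //= !big_geq.
have b3 : beta 3 = 147%N by rewrite /beta !big_nat_recr //= !big_geq.
have b4 : beta 4 = 1251%N by rewrite /beta !big_nat_recr //= !big_geq.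
have h4 : harmonic 4 = 25 / 12.
  rewrite /harmonic; do 4![rewrite big_ltn; last by []].
  by rewrite big_geq; [field | by []].
have i12 : O 0 12%:R^-1 by apply: pow_dvd_inv_coprime; apply: cop.
have i2 : O 0 2%:R^-1 by apply: pow_dvd_inv_coprime; apply: cop.
have i6 : O 0 6%:R^-1 by apply: pow_dvd_inv_coprime; apply: cop.
have i4 : O 0 4%:R^-1 by apply: pow_dvd_inv_coprime; apply: cop.
have pE : p.-1 = 4%N by rewrite p5.
have p0 : (p - 5 = 0)%N by rewrite p5.
rewrite /beta_sum_congruences pE h4 p0 bernoulli0.
have sE (f : nat -> rat) :
    \sum_(0 <= k < p) f k = f 0%N + f 1%N + f 2%N + f 3%N + f 4%N.
  by rewrite p5 !big_nat_recr //= big_geq // add0r.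
have qE : p%:R = 5 :> rat by rewrite p5.
rewrite !sE b0 b1 b2 b3 b4.
split; (apply: pow_dvd_eqmod; [by rewrite -pow_dvd0E; integral|]).
(* For p = 5 the first congruence is an equality. In the other two the differences are exactly 5^8
   times 5/6 and 11/4. *)
- rewrite (_ : _ - _ = p%:R ^+ 8 * 0); first by apply: pow_dvd_mulp; exact: pow_dvd_zero.
  by rewrite qE; field.
- rewrite (_ : _ - _ = p%:R ^+ 8 * (5 * 6^-1)); first by apply: pow_dvd_mulp; integral.
  by rewrite qE; field.
rewrite (_ : _ - _ = p%:R ^+ 8 * (11 * 4^-1)); first by apply: pow_dvd_mulp; integral.
by rewrite qE; field.
Qed.

(** * Inverse power sums and harmonic sums for p > 5 *)

Hypothesis p_gt5 : (5 < p)%N.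

Let ge7 : (7 <= p)%N.
Proof. by rewrite ltn_neqAle p_gt5 andbT; apply: contraTneq p_prime => <-. Qed.

Let cop_small k : (0 < k < 7)%N -> coprime p k.
Proof. by move=> hk; apply: coprime_lt_prime; lia. Qed.

Let p_odd : odd p.
Proof. by case: (even_prime p_prime) => // p2; move: p_gt5; rewrite p2. Qed.

Local Notation hs k := (\sum_(1 <= i < p) i%:R ^- k : rat).

(* [doubling_sum] applied to [j ^- 4] and to [j ^+ (p - 5)] compares the two sums
   modulo [p ^ 2]. *)
Lemma quartic_inverse_sum :
  O 2 (5 * hs 4 - 4 * (p%:R * bernoulli (p - 5))).
Proof.
set B := bernoulli _; pose m := (p - 5)%N; pose h := p./2.
pose S : rat := \sum_(1 <= i < p) i%:R ^+ m.
pose Z : rat := \sum_(0 <= j < h) j.*2.+1%:R ^- 5.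
have ph : p = h.*2.+1 by rewrite -[LHS]odd_double_half p_odd.
have hj j : (j < h)%N -> (0 < j.*2.+1 < p)%N by move=> lt_jh; lia.
have S1 : O 1 S by apply: power_sum_pow_dvd; rewrite /m; lia.
have SB : O 2 (S - p%:R * B).
  have := @power_sum_bernoulli m; rewrite big_ltn ?prime_gt0 // expr0n gtn_eqF ?add0r;
    last by rewrite /m; lia.
  by apply; rewrite /m; lia.
(* For odd s < p, (p + s)^-4 - s^-4 is -4 p s^-5 modulo p^2. *)
have d4 : O 2 ((2 ^- 4 - 1) * hs 4 + 4 * p%:R * Z).
  pose g n : rat := n%:R ^- 4.
  have := doubling_sum h g; rewrite -ph.
  have -> : \sum_(1 <= i < p) g i.*2 = 2 ^- 4 * hs 4.
    rewrite mulr_sumr; apply: eq_bigr => i _.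
    by rewrite /g -muln2 natrM exprMn invfM mulrC.
  rewrite -{2}[\sum_(1 <= i < p) g i]mul1r -mulrBl => ->.
  rewrite mulr_sumr -big_split /=; apply: pow_dvd_sum_nat => j /andP[_ /hj hj'].
  rewrite /g; set s := j.*2.+1 in hj' *.
  have nz : s%:R != 0 :> rat by rewrite pnatr_eq0; lia.
  have cps : coprime p (p + s) by rewrite /coprime gcdnDl; apply: coprime_lt_prime.
  have nz' : p%:R + s%:R != 0 :> rat by rewrite -natrD pnatr_eq0; lia.
  rewrite natrD; pose y : rat := s%:R^-1; pose z : rat := (p%:R + s%:R)^-1.
  have iy : O 0 y by rewrite pow_dvd_inv.
  have iz : O 0 z by rewrite /z -natrD pow_dvd_inv_coprime.
  have zE : O 2 (z - (y - p%:R * y ^+ 2)).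
    rewrite (_ : _ - _ = p%:R ^+ 2 * (y ^+ 2 * z)); first by apply: pow_dvd_mulp; integral.
    by rewrite /z /y; field; rewrite nz nz'.
  have iw : O 0 (y - p%:R * y ^+ 2) by integral.
  have h4 := pow_dvd_subX 4 iz iw zE.
  rewrite (_ : _ + _ = (z ^+ 4 - (y - p%:R * y ^+ 2) ^+ 4)
    + p%:R ^+ 2 * (6 * y ^+ 6 - 4 * p%:R * y ^+ 7 + p%:R ^+ 2 * y ^+ 8)).
    by apply: (pow_dvdD h4); apply: pow_dvd_mulp; integral.
  by rewrite /z /y -!exprVn; ring.
(* Likewise (p + s)^m - s^m is m p s^(m - 1), hence -5 p s^-5 modulo p^2, by m = p - 5 and
   Fermat. *)
have dm : O 2 ((2 ^+ m - 1) * S + 5 * p%:R * Z).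
  pose g n : rat := n%:R ^+ m.
  have := doubling_sum h g; rewrite -ph.
  have -> : \sum_(1 <= i < p) g i.*2 = 2 ^+ m * S.
    rewrite mulr_sumr; apply: eq_bigr => i _.
    by rewrite /g -muln2 natrM exprMn mulrC.
  rewrite -[\sum_(1 <= i < p) g i]/S -{2}[S]mul1r -mulrBl => ->.
  rewrite mulr_sumr -big_split /=; apply: pow_dvd_sum_nat => j /andP[_ /hj hj'].
  rewrite /g natrD; set s := j.*2.+1 in hj' *.
  have m1 : m = m.-1.+1 by rewrite prednK // /m; lia.
  have := pow_dvd_first_order m.-1 (pow_dvd_nat s); rewrite -m1.
  have hF : O 1 (s%:R ^- 5 - s%:R ^+ m.-1).
    by have := @inverse_power_fermat s 5 hj';
      rewrite (_ : p.-1 - 5 = m.-1)%N; [apply; lia|rewrite /m; lia].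
  have mE : m%:R = p%:R - 5 :> rat by rewrite /m natrB ?(ltnW p_gt5).
  rewrite mE => hf.
  rewrite (_ : _ + _ = ((p%:R + s%:R) ^+ m - s%:R ^+ m - (p%:R - 5) * p%:R * s%:R ^+ m.-1)
    + p%:R ^+ 2 * s%:R ^+ m.-1 + 5 * (p%:R ^+ 1 * (s%:R ^- 5 - s%:R ^+ m.-1))); last by ring.
  apply: pow_dvdD; first by apply: (pow_dvdD hf); apply: pow_dvd_mulp; integral.
  by apply: pow_dvdMl; [integral | rewrite (pow_dvd_pM 1 1)].
have p2 : O 1 (2 ^- 4 - 2 ^+ m).
  by have := @inverse_power_fermat 2 4; rewrite (_ : p.-1 - 4 = m)%N; [apply; lia|rewrite /m; lia].
(* This combination eliminates [Z]. Since p divides [S], replacing 2^m by 2^-4 in front of it is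
   harmless modulo p^2; 15 comes from 2^4 - 1 and is a unit for p > 5. *)
have d : O 2 (15 * (5 * hs 4 - 4 * S)).
  rewrite (_ : 15 * _ = 16 * (4 * ((2 ^- 4 - 2 ^+ m) * S)
     + 4 * ((2 ^+ m - 1) * S + 5 * p%:R * Z)
     - 5 * ((2 ^- 4 - 1) * hs 4 + 4 * p%:R * Z))); last by field.
  apply: pow_dvdMl; first by integral.
  apply: pow_dvdD; last by rewrite pow_dvdN; apply: pow_dvdMl; [integral|].
  apply: pow_dvdD; apply: pow_dvdMl => //; [integral| |integral].
  exact: (@pow_dvdM 1 1).
have {}d : O 2 (5 * hs 4 - 4 * S).
  by move: d; apply: pow_dvd_unit; rewrite (coprimeMr p 3 5) !cop_small.
rewrite (_ : _ - _ = (5 * hs 4 - 4 * S) + 4 * (S - p%:R * B)); last by ring.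
apply: pow_dvdD; [exact: d | apply: pow_dvdMl; [integral | exact: SB]].
Qed.

(** [A j] and [D j] stop before [j]: they are H_(j-1) and H^(2)_(j-1), as in the expansion of W(x,
    j). *)
Local Notation A j := (\sum_(1 <= i < j) i%:R^-1 : rat).
Local Notation D j := (\sum_(1 <= i < j) i%:R^-1 ^+ 2 : rat).
Local Notation H k := (\sum_(1 <= j < p) j%:R^-1 ^+ k : rat).

Lemma inverse_sum_pow_dvd k : (0 < k < 6)%N -> O 1 (H k).
Proof.
move=> hk; rewrite (eq_bigr (fun i => i%:R ^- k)) => [|i _]; last by rewrite exprVn.
by apply: inverse_power_sum_pow_dvd; lia.
Qed.

(** Substituting this exact identity into itself expands 1/(p - j) to any order in p. *)
Lemma inverse_rev j : (0 < j < p)%N ->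
  (p - j)%:R^-1 = - j%:R^-1 + p%:R * j%:R^-1 * (p - j)%:R^-1 :> rat.
Proof.
move=> hj; have nz : j%:R != 0 :> rat by rewrite pnatr_eq0; lia.
have nz' : p%:R - j%:R != 0 :> rat by rewrite -natrB ?pnatr_eq0; lia.
have -> : (p - j)%:R = p%:R - j%:R :> rat by rewrite natrB //; lia.
by field; rewrite nz nz'.
Qed.

Lemma inverse_rev_mod3 j : (0 < j < p)%N ->
  O 3 ((p - j)%:R^-1
       - - (j%:R^-1 + p%:R * j%:R^-1 ^+ 2 + p%:R ^+ 2 * j%:R^-1 ^+ 3)).
Proof.
move=> hj; have e := inverse_rev hj.
set y := j%:R^-1 in e *; set z := _^-1 in e *.
have iy : O 0 y by apply: pow_dvd_inv.
have iz : O 0 z by apply: pow_dvd_inv; lia.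
have -> : z - - (y + p%:R * y ^+ 2 + p%:R ^+ 2 * y ^+ 3) = p%:R ^+ 3 * (y ^+ 3 * z).
  by rewrite {1}e {1}e {1}e; ring.
by apply: pow_dvd_mulp; integral.
Qed.

Lemma inverse_rev_mod2 j : (0 < j < p)%N ->
  O 2 ((p - j)%:R^-1 - - (j%:R^-1 + p%:R * j%:R^-1 ^+ 2)).
Proof.
move=> hj; have /(@pow_dvd_leq 2 3 _ isT) h := inverse_rev_mod3 hj.
have iy : O 0 j%:R^-1 by apply: pow_dvd_inv.
rewrite (_ : _ - _ = ((p - j)%:R^-1
       - - (j%:R^-1 + p%:R * j%:R^-1 ^+ 2 + p%:R ^+ 2 * j%:R^-1 ^+ 3))
   + p%:R ^+ 2 * (- j%:R^-1 ^+ 3)); last by ring.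
by apply: (pow_dvdD h); apply: pow_dvd_mulp; integral.
Qed.

(** Wolstenholme's congruence. Pairing j with p - j gives -p times the sum of 1/j^2 modulo p^2, and
    p divides that sum. *)
Lemma harmonic_pow_dvd : O 2 (H 1).
Proof.
apply: (@pow_dvd_unit _ 2); first exact: cop_small.
have -> : 2%:R * H 1 = \sum_(1 <= j < p) (j%:R^-1 + (p - j)%:R^-1).
  by rewrite mulr_natl mulr2n {2}sum_nat_rev -big_split.
apply: (@pow_dvd_sub _ (- (p%:R ^+ 1 * H 2))).
  rewrite opprK mulr_sumr -big_split; apply: pow_dvd_sum_nat => j hj /=.
  have -> : j%:R^-1 + (p - j)%:R^-1 + p%:R ^+ 1 * j%:R^-1 ^+ 2 =
    (p - j)%:R^-1 - - (j%:R^-1 + p%:R * j%:R^-1 ^+ 2) :> rat by ring.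
  exact: inverse_rev_mod2.
by rewrite pow_dvdN (pow_dvd_pM 1 1) inverse_sum_pow_dvd.
Qed.

(** Under j -> p - j the sum of the two cubes is -3 p/j^4 - 6 p^2/j^5 modulo p^3, and p divides the
    sum of 1/j^5. *)
Lemma cubic_inverse_sum : O 3 (2 * H 3 + 3 * p%:R * H 4).
Proof.
have -> : 2 * H 3 = \sum_(1 <= j < p) (j%:R^-1 ^+ 3 + (p - j)%:R^-1 ^+ 3).
  by rewrite mulr_natl mulr2n {2}sum_nat_rev -big_split.
apply: (@pow_dvd_sub _ (- (p%:R ^+ 2 * (6 * H 5)))).
  rewrite opprK !mulr_sumr -!big_split; apply: pow_dvd_sum_nat => j hj /=.
  have h := inverse_rev_mod3 hj.
  set y := j%:R^-1 in h *; set z := _^-1 in h *.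
  have iy : O 0 y by apply: pow_dvd_inv.
  have iz : O 0 z by apply: pow_dvd_inv; lia.
  pose w : rat := - (y + p%:R * y ^+ 2 + p%:R ^+ 2 * y ^+ 3).
  have iw : O 0 w by rewrite /w; integral.
  have h3 := pow_dvd_subX 3 iz iw h.
  have -> : y ^+ 3 + z ^+ 3 + 3 * p%:R * y ^+ 4 + p%:R ^+ 2 * (6 * y ^+ 5) =
     (z ^+ 3 - w ^+ 3) + p%:R ^+ 3 * - (7 * y ^+ 6
     + 6 * p%:R * y ^+ 7 + 3 * p%:R ^+ 2 * y ^+ 8 + p%:R ^+ 3 * y ^+ 9).
    by rewrite /w; ring.
  by apply: (pow_dvdD h3); apply: pow_dvd_mulp; integral.
rewrite pow_dvdN (pow_dvd_pM 2 1); apply: pow_dvdMl; first by integral.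
by rewrite inverse_sum_pow_dvd.
Qed.

(** As H_(p-1) vanishes modulo p^2, H_(p-1-j) is minus the sum of 1/(p - i) over i <= j, which is
    then expanded to first order. *)
Lemma partial_harmonic_rev j : (0 < j < p)%N ->
  O 2 (A (p - j) - (A j + j%:R^-1 + p%:R * (D j + j%:R^-1 ^+ 2))).
Proof.
move=> hj.
have split : H 1 = A (p - j) + \sum_(1 <= i < j.+1) (p - i)%:R^-1.
  rewrite (@big_cat_nat _ _ _ (p - j)) /=; try lia.
  congr (_ + _); rewrite (_ : (p - j = 0 + (p - j))%N) // big_addn.
  rewrite big_nat_rev (_ : (p - (p - j) = j)%N); last by lia.
  rewrite big_add1 /=; apply: eq_big_nat => i hi; congr (_%:R^-1); lia.
have -> : A j + j%:R^-1 = A j.+1 by rewrite big_nat_recr //; lia.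
have -> : D j + j%:R^-1 ^+ 2 = D j.+1 by rewrite big_nat_recr //; lia.
rewrite (_ : _ - _ = H 1 - \sum_(1 <= i < j.+1)
   ((p - i)%:R^-1 - - (i%:R^-1 + p%:R * i%:R^-1 ^+ 2))).
  apply: pow_dvdB; first exact: harmonic_pow_dvd.
  by apply: pow_dvd_sum_nat => i hi; apply: inverse_rev_mod2; lia.
by rewrite split sumrB sumrN big_split -mulr_sumr /=; ring.
Qed.

Lemma partial_harmonic_pow_dvd j : (j <= p)%N -> O 0 (A j).
Proof. by move=> hj; apply: pow_dvd_sum_nat => i hi; apply: pow_dvd_inv; lia. Qed.

Lemma partial_square_pow_dvd j : (j <= p)%N -> O 0 (D j).
Proof.
by move=> hj; apply: pow_dvd_sum_nat => i hi; apply: pow_dvdX; apply: pow_dvd_inv; lia.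
Qed.

Local Notation X := (\sum_(1 <= j < p) A j * j%:R^-1 ^+ 3).
Local Notation Y := (\sum_(1 <= j < p) A j ^+ 2 * j%:R^-1 ^+ 3).
Local Notation U := (\sum_(1 <= j < p) A j * j%:R^-1 ^+ 4).
Local Notation V := (\sum_(1 <= j < p) D j * j%:R^-1 ^+ 3).
Local Notation B := (bernoulli (p - 5)).

(** In the sum of the terms at j and p - j the parts H_(j-1)/j^3 cancel. The leftover 4 p/j^5 sums
    to 0 modulo p^2. *)
Lemma harmonic_cubic_sum : O 2 (2 * X + H 4 + p%:R * V + 3 * p%:R * U).
Proof.
have -> : 2 * X = \sum_(1 <= j < p)
    (A j * j%:R^-1 ^+ 3 + A (p - j) * (p - j)%:R^-1 ^+ 3).
  by rewrite mulr_natl mulr2n {2}sum_nat_rev -big_split.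
apply: (@pow_dvd_sub _ (- (p%:R ^+ 1 * (4 * H 5)))); last first.
  rewrite pow_dvdN (pow_dvd_pM 1 1); apply: pow_dvdMl; first by integral.
  by rewrite inverse_sum_pow_dvd.
rewrite opprK !mulr_sumr -!big_split; apply: pow_dvd_sum_nat => j hj /=.
have h := inverse_rev_mod2 hj; have ha := partial_harmonic_rev hj.
have ia : O 0 (A j) by apply: partial_harmonic_pow_dvd; lia.
have id : O 0 (D j) by apply: partial_square_pow_dvd; lia.
have ia' : O 0 (A (p - j)) by apply: partial_harmonic_pow_dvd; lia.
set a := A j in ha ia *; set d := D j in ha id *; set a' := A (p - j) in ha ia' *.
set y := j%:R^-1 in h ha *; set z := _^-1 in h *.
have iy : O 0 y by apply: pow_dvd_inv.
have iz : O 0 z by apply: pow_dvd_inv; lia.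
pose w : rat := - (y + p%:R * y ^+ 2).
pose b : rat := a + y + p%:R * (d + y ^+ 2).
have iw : O 0 w by rewrite /w; integral.
have h3 := pow_dvd_subX 3 iz iw h.
have -> : a * y ^+ 3 + a' * z ^+ 3 + y ^+ 4 + p%:R * (d * y ^+ 3)
    + 3 * p%:R * (a * y ^+ 4) + p%:R ^+ 1 * (4 * y ^+ 5)
  = a' * (z ^+ 3 - w ^+ 3) + w ^+ 3 * (a' - b)
    + p%:R ^+ 2 * - (3 * d * y ^+ 4 + 3 * y ^+ 6
        + (a + y + p%:R * (d + y ^+ 2)) * (3 * y ^+ 5 + p%:R * y ^+ 6)).
  by rewrite /w /b; ring.
apply: pow_dvdD; last by apply: pow_dvd_mulp; integral.
apply: pow_dvdD; apply: pow_dvdMl; [exact: ia' | exact: h3 | integral | exact: ha].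
Qed.

(** Modulo p the reflected term is -(H_(j-1) + 1/j)^2 / j^3: the squares cancel, and the sum of
    1/j^5 vanishes. *)
Lemma harmonic_square_cubic_sum : O 1 (Y + U).
Proof.
apply: (@pow_dvd_unit _ 2); first exact: cop_small.
have -> : 2%:R * (Y + U) = \sum_(1 <= j < p)
    (A j ^+ 2 * j%:R^-1 ^+ 3 + A (p - j) ^+ 2 * (p - j)%:R^-1 ^+ 3) + 2 * U.
  by rewrite mulrDr {1}mulr_natl mulr2n {2}sum_nat_rev -big_split.
apply: (@pow_dvd_sub _ (- H 5)); last by rewrite pow_dvdN inverse_sum_pow_dvd.
rewrite opprK !mulr_sumr -!big_split; apply: pow_dvd_sum_nat => j hj /=.
have /(@pow_dvd_leq 1 2 _ isT) h := inverse_rev_mod2 hj.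
have /(@pow_dvd_leq 1 2 _ isT) ha := partial_harmonic_rev hj.
have ia : O 0 (A j) by apply: partial_harmonic_pow_dvd; lia.
have id : O 0 (D j) by apply: partial_square_pow_dvd; lia.
have ia' : O 0 (A (p - j)) by apply: partial_harmonic_pow_dvd; lia.
set a := A j in ha ia *; set d := D j in ha id *; set a' := A (p - j) in ha ia' *.
set y := j%:R^-1 in h ha *; set z := _^-1 in h *.
have iy : O 0 y by apply: pow_dvd_inv.
have iz : O 0 z by apply: pow_dvd_inv; lia.
have {}h : O 1 (z - - y).
  rewrite (_ : _ - _ = z - - (y + p%:R * y ^+ 2) + p%:R ^+ 1 * - y ^+ 2); last by ring.
  by apply: (pow_dvdD h); apply: pow_dvd_mulp; integral.
have {}ha : O 1 (a' - (a + y)).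
  rewrite (_ : _ - _ = a' - (a + y + p%:R * (d + y ^+ 2)) + p%:R ^+ 1 * (d + y ^+ 2)).
    by apply: (pow_dvdD ha); apply: pow_dvd_mulp; integral.
  by ring.
have iy' : O 0 (- y) by integral.
have iay : O 0 (a + y) by integral.
have h3 := pow_dvd_subX 3 iz iy' h; have h2 := pow_dvd_subX 2 ia' iay ha.
have -> : a ^+ 2 * y ^+ 3 + a' ^+ 2 * z ^+ 3 + 2 * (a * y ^+ 4) + y ^+ 5
  = a' ^+ 2 * (z ^+ 3 - (- y) ^+ 3) + (- y) ^+ 3 * (a' ^+ 2 - (a + y) ^+ 2) by ring.
by apply: pow_dvdD; apply: pow_dvdMl; [integral | exact: h3 | integral | exact: h2].
Qed.

Lemma harmonic_quartic_sum_pow_dvd : O 0 U.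
Proof.
apply: pow_dvd_sum_nat => j hj.
have ia : O 0 (A j) by apply: partial_harmonic_pow_dvd; lia.
by integral.
Qed.

Lemma square_cubic_sum_pow_dvd : O 0 V.
Proof.
apply: pow_dvd_sum_nat => j hj.
have id : O 0 (D j) by apply: partial_square_pow_dvd; lia.
by integral.
Qed.

Let bernoulli_integral : O 0 B.
Proof. by apply: bernoulli_pow_dvd; lia. Qed.

(** The case a = 1, b = 4 of the double sum, with binomial(p - 1, 4) congruent to 1. The factor 24
    clears the denominator of the binomial. *)
Lemma harmonic_quartic_sum : O 1 (U - B).
Proof.
have iB := bernoulli_integral; have iU := harmonic_quartic_sum_pow_dvd.
have := @double_sum_bernoulli 1 4 isT isT; rewrite (_ : (1 + 4 < p.-1)%N); last by lia.
move=> /(_ isT).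
rewrite (eq_bigr (fun j => A j * j%:R^-1 ^+ 4)) => [|j _]; last by rewrite exprVn.
have e : (p - 1)%:R = p%:R - 1 :> rat by rewrite natrB //; lia.
rewrite !natr_bin_left bin0 e => h.
apply: (@pow_dvd_unit _ 24); first by rewrite (coprimeMr p 4 6) !cop_small.
have -> : 24%:R * (U - B) = - 24%:R * ((p%:R - 1%:R) * U - (p%:R - 1) *
   (1%:R * (p%:R - 1 - 0%:R) / 1%:R * (p%:R - 1 - 1%:R) / 2%:R
    * (p%:R - 1 - 2%:R) / 3%:R * (p%:R - 1 - 3%:R) / 4%:R) * B)
  + p%:R ^+ 1 * (24 * U - (p%:R ^+ 4 - 11 * p%:R ^+ 3 + 45 * p%:R ^+ 2
                           - 85 * p%:R + 74) * B).
  by field.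
apply: pow_dvdD; last by apply: pow_dvd_mulp; integral.
by apply: pow_dvdMl; [integral | exact: h].
Qed.

(** The case a = 2, b = 3, with binomial(p - 2, 3) congruent to -4. *)
Lemma square_cubic_sum : O 1 (V + 2 * B).
Proof.
have iB := bernoulli_integral; have iV := square_cubic_sum_pow_dvd.
have := @double_sum_bernoulli 2 3 isT isT; rewrite (_ : (2 + 3 < p.-1)%N); last by lia.
move=> /(_ isT).
rewrite (eq_bigr (fun j => D j * j%:R^-1 ^+ 3)) => [|j _]; last first.
  by rewrite exprVn; congr (_ * _); apply: eq_bigr => i _; rewrite exprVn.
have e : (p - 2)%:R = p%:R - 2 :> rat by rewrite natrB //; lia.
rewrite !natr_bin_left bin0 e => h.
apply: (@pow_dvd_unit _ 12); first by rewrite (coprimeMr p 2 6) !cop_small.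
have -> : 12%:R * (V + 2 * B) = - 6%:R * ((p%:R - 2%:R) * V - (p%:R - 1) *
   (1%:R * (p%:R - 2 - 0%:R) / 1%:R * (p%:R - 2 - 1%:R) / 2%:R
    * (p%:R - 2 - 2%:R) / 3%:R) * B)
  + p%:R ^+ 1 * (6 * V - (p%:R ^+ 3 - 10 * p%:R ^+ 2 + 35 * p%:R - 50) * B).
  by field.
apply: pow_dvdD; last by apply: pow_dvd_mulp; integral.
by apply: pow_dvdMl; [integral | exact: h].
Qed.

(** * Expansion of products modulo powers of p *)

Let half_integral : O 0 2%:R^-1.
Proof. by apply: pow_dvd_inv_coprime; apply: cop_small. Qed.

(** The product is the sum of the elementary symmetric functions of the u_i. The second is (s1^2 -
    s2)/2 in terms of power sums, and those from the third on have order 3n. *)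
Lemma prod_second_order n (u : nat -> rat) j :
  (forall i, (1 <= i < j)%N -> O n (u i)) ->
  O (n + n + n) (\prod_(1 <= i < j) (1 + u i)
     - (1 + \sum_(1 <= i < j) u i
        + ((\sum_(1 <= i < j) u i) ^+ 2 - \sum_(1 <= i < j) u i ^+ 2) / 2)).
Proof.
elim: j => [|j IH] hu.
  by rewrite !big_geq // (_ : _ - _ = 0) ?pow_dvd_zero //; ring.
have [->|j_gt0] := posnP j.
  by rewrite !big_geq // (_ : _ - _ = 0) ?pow_dvd_zero //; ring.
have hu' i : (1 <= i < j)%N -> O n (u i) by move=> hi; apply: hu; lia.
have {}IH := IH hu'; have huj : O n (u j) by apply: hu; lia.
have is1 : O n (\sum_(1 <= i < j) u i) by apply: pow_dvd_sum_nat.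
have is2 : O (n + n) (\sum_(1 <= i < j) u i ^+ 2).
  by apply: pow_dvd_sum_nat => i /hu' h; rewrite expr2; apply: (pow_dvdM h h).
rewrite !(big_nat_recr j) //=.
set P := \prod_(1 <= i < j) _ in IH *; set s1 := \sum_(1 <= i < j) u i in IH is1 *.
set s2 := \sum_(1 <= i < j) _ in IH is2 *; set v := u j in huj *.
have -> : P * (1 + v) - (1 + (s1 + v) + ((s1 + v) ^+ 2 - (s2 + v ^+ 2)) / 2) =
    (P - (1 + s1 + (s1 ^+ 2 - s2) / 2)) + (P - (1 + s1 + (s1 ^+ 2 - s2) / 2)) * v
    + (s1 * s1 - s2) / 2 * v by field.
have iv : O 0 v by apply: pow_dvd_leq huj.
apply: pow_dvdD; first by apply: (pow_dvdD IH); apply: pow_dvdMr; [exact: IH | exact: iv].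
apply: (pow_dvdM _ huj); apply: pow_dvdMr; last exact: half_integral.
by apply: pow_dvdB; [exact: (pow_dvdM is1 is1) | exact: is2].
Qed.

(** The parameter c serves both x = p and x = -p. *)
Lemma beta_prod_mod3 c j : O 0 c -> (j <= p)%N ->
  O 3 (beta_prod (p%:R * c) j
       - (1 - p%:R * c * A j + (p%:R * c) ^+ 2 * (A j ^+ 2 - 3 * D j) / 2)).
Proof.
move=> ic le_jp; have ih := half_integral.
pose x := p%:R * c; have ix : O 0 x by rewrite /x; integral.
(* From (1 - t)^2 (1 + t) = 1 - t - t^2 + t^3 with t = x/i. *)
pose u i : rat := - x * i%:R^-1 - x ^+ 2 * i%:R^-1 ^+ 2 + x ^+ 3 * i%:R^-1 ^+ 3.
have hu i : (1 <= i < j)%N -> O 1 (u i).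
  move=> hi; have iy : O 0 i%:R^-1 by apply: pow_dvd_inv; lia.
  have -> : u i = p%:R ^+ 1 * (c * (- i%:R^-1 - x * i%:R^-1 ^+ 2
                               + x ^+ 2 * i%:R^-1 ^+ 3)) by rewrite /u /x; ring.
  by apply: pow_dvd_mulp; integral.
have := prod_second_order hu.
have -> : \prod_(1 <= i < j) (1 + u i) = beta_prod x j.
  by apply: eq_bigr => i _; rewrite /u; ring.
pose C := \sum_(1 <= i < j) i%:R^-1 ^+ 3 : rat.
have iC : O 0 C.
  apply: pow_dvd_sum_nat => i hi; have iy : O 0 i%:R^-1 by apply: pow_dvd_inv; lia.
  by integral.
have -> : \sum_(1 <= i < j) u i = - x * A j - x ^+ 2 * D j + x ^+ 3 * C.
  transitivity (- x * A j + - x ^+ 2 * D j + x ^+ 3 * C); last by ring.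
  by rewrite !mulr_sumr -!big_split /=; apply: eq_bigr => i _; rewrite /u; ring.
have hs2 : O 3 (\sum_(1 <= i < j) u i ^+ 2 - x ^+ 2 * D j).
  rewrite mulr_sumr -sumrB; apply: pow_dvd_sum_nat => i hi.
  have iy : O 0 i%:R^-1 by apply: pow_dvd_inv; lia.
  set y := i%:R^-1 in iy *.
  have -> : u i ^+ 2 - x ^+ 2 * y ^+ 2 = p%:R ^+ 3 * (c ^+ 3 *
     (2 * y ^+ 3 - x * y ^+ 4 - 2 * x ^+ 2 * y ^+ 5 + x ^+ 3 * y ^+ 6)).
    by rewrite /u -/y /x; ring.
  by apply: pow_dvd_mulp; integral.
have ia : O 0 (A j) by apply: partial_harmonic_pow_dvd.
have id : O 0 (D j) by apply: partial_square_pow_dvd.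
move: hs2; set s2 := \sum_(1 <= i < j) _ ^+ 2 => hs2 h.
move: h hs2 ia id; set W := beta_prod _ _; set a := A j; set d := D j => h hs2 ia id.
have -> : W - (1 - x * a + x ^+ 2 * (a ^+ 2 - 3 * d) / 2) =
   (W - (1 + (- x * a - x ^+ 2 * d + x ^+ 3 * C)
      + ((- x * a - x ^+ 2 * d + x ^+ 3 * C) ^+ 2 - s2) / 2))
   + 2%:R^-1 * - (s2 - x ^+ 2 * d)
   + p%:R ^+ 3 * (c ^+ 3 * (C + 2%:R^-1 * (2 * a * d + x * d ^+ 2
        - 2 * x * a * C - 2 * x ^+ 2 * d * C + x ^+ 3 * C ^+ 2))).
  by rewrite /x; field.
apply: pow_dvdD; last by apply: pow_dvd_mulp; integral.
apply: (pow_dvdD h); apply: pow_dvdMl; first exact: ih.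
by rewrite pow_dvdN; exact: hs2.
Qed.

Lemma beta_prod_sum_mod6 c : O 0 c ->
  O 6 (\sum_(1 <= j < p) beta_prod (p%:R * c) j * (p%:R / j%:R) ^+ 3
       - p%:R ^+ 3 * (H 3 - p%:R * c * X + (p%:R * c) ^+ 2 * (Y - 3 * V) / 2)).
Proof.
move=> ic; set x := p%:R * c.
have -> : H 3 - x * X + x ^+ 2 * (Y - 3 * V) / 2 = \sum_(1 <= j < p)
    (1 - x * A j + x ^+ 2 * (A j ^+ 2 - 3 * D j) / 2) * j%:R^-1 ^+ 3.
  transitivity (H 3 + - x * X + x ^+ 2 / 2 * Y + - (3 * x ^+ 2 / 2) * V : rat).
    by field.
  by rewrite !mulr_sumr -!big_split /=; apply: eq_bigr => j _; ring.
rewrite mulr_sumr -sumrB; apply: pow_dvd_sum_nat => j hj.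
have h : O 3 (beta_prod x j - (1 - x * A j + x ^+ 2 * (A j ^+ 2 - 3 * D j) / 2)).
  by apply: beta_prod_mod3 => //; lia.
rewrite (_ : _ - _ = p%:R ^+ 3 * (j%:R^-1 ^+ 3 *
    (beta_prod x j - (1 - x * A j + x ^+ 2 * (A j ^+ 2 - 3 * D j) / 2)))).
  rewrite (pow_dvd_pM 3 3); apply: pow_dvdMl; last exact: h.
  by integral.
by rewrite exprMn; ring.
Qed.

Local Notation Pi := (\prod_(1 <= i < p) (1 + p%:R * i%:R^-1) : rat).

(** The factors are -(p - i)/i: the numerators p - i permute the denominators, and the number p - 1
    of signs is even. *)
Lemma prod_sub_eq1 : \prod_(1 <= i < p) (1 - p%:R * i%:R^-1) = 1 :> rat.
Proof.
have -> : \prod_(1 <= i < p) (1 - p%:R * i%:R^-1) =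
    \prod_(1 <= i < p) (-1 * (p - i)%:R / i%:R) :> rat.
  apply: eq_big_nat => i hi; have nz : i%:R != 0 :> rat by rewrite pnatr_eq0; lia.
  by rewrite natrB ?mulN1r; [field | lia].
have nz : \prod_(1 <= i < p) i%:R != 0 :> rat.
  rewrite big_nat; elim/big_ind: _ => [|x y|i hi]; first exact: oner_neq0.
    exact: mulf_neq0.
  by rewrite pnatr_eq0; lia.
rewrite prodf_div big_split /= [X in _ * X / _]big_nat_rev /=.
have -> : \prod_(1 <= i < p) (p - (1 + p - i.+1))%:R = \prod_(1 <= i < p) i%:R :> rat.
  by apply: eq_big_nat => i hi; congr _%:R; lia.
rewrite mulfK // prodr_const_nat -signr_odd oddB ?p_odd //; lia.
Qed.

Lemma beta_prod_p : beta_prod (p%:R * 1) p = Pi.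
Proof.
rewrite /beta_prod big_split /= -[RHS]mul1r mulr1; congr (_ * _).
by rewrite prodrXl prod_sub_eq1 expr1n.
Qed.

Lemma beta_prodN_p : beta_prod (p%:R * -1) p = Pi ^+ 2.
Proof.
rewrite /beta_prod big_split /= -[RHS]mulr1 mulrN1; congr (_ * _).
  by rewrite prodrXl; congr (_ ^+ 2); apply: eq_bigr => i _; rewrite mulNr opprK.
by rewrite -[RHS]prod_sub_eq1; apply: eq_bigr => i _; rewrite mulNr.
Qed.

(* Squaring pairs the factors [i] and [p - i], which leaves only even powers of [p]. *)
Lemma prod_add_square : Pi ^+ 2 =
  \prod_(1 <= i < p) (1 + 2 * p%:R ^+ 2 * (i%:R^-1 * (p - i)%:R^-1)).
Proof.
have -> : Pi ^+ 2 = Pi * \prod_(1 <= i < p) (1 + p%:R * (p - i)%:R^-1).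
  rewrite expr2; congr (_ * _); rewrite [LHS]big_nat_rev /=.
  by apply: eq_big_nat => i hi; congr (1 + p%:R * _%:R^-1); lia.
rewrite -big_split; apply: eq_big_nat => i hi /=.
have e := inverse_rev hi; set y := i%:R^-1 in e *; set z := _^-1 in e *.
transitivity (1 + p%:R * y + p%:R * z + p%:R ^+ 2 * y * z); first by ring.
by rewrite {1}e; ring.
Qed.

(** Once p^3 divides P - 1, the square (P - 1)^2 vanishes modulo p^6, so P - 1 is (P^2 - 1)/2 there,
    and P^2 is expanded from its paired form. *)
Lemma prod_add_mod6 :
  O 3 (Pi - 1) /\ O 6 (Pi - 1 - (2 * p%:R * H 1 - p%:R ^+ 4 * H 4)).
Proof.
have ih := half_integral.
have h1 := harmonic_pow_dvd; have h2 : O 1 (H 2) by apply: inverse_sum_pow_dvd.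
have h5 : O 1 (H 5) by apply: inverse_sum_pow_dvd.
have w3 : O 3 (Pi - 1).
  have hu i : (1 <= i < p)%N -> O 1 (p%:R * i%:R^-1).
    by move=> hi; apply: (@pow_dvd_mulp 1); apply: pow_dvd_inv.
  have := prod_second_order hu; rewrite -mulr_sumr.
  have -> : \sum_(1 <= i < p) (p%:R * i%:R^-1) ^+ 2 = p%:R ^+ 2 * H 2 :> rat.
    by rewrite mulr_sumr; apply: eq_bigr => i _; rewrite exprMn.
  rewrite -[\sum_(1 <= i < p) i%:R^-1]/(H 1).
  move: h1 h2; set a := H 1; set b := H 2; set P := Pi => h1 h2 h.
  have -> : P - 1 = (P - (1 + p%:R * a + ((p%:R * a) ^+ 2 - p%:R ^+ 2 * b) / 2))
     + p%:R ^+ 1 * a + 2%:R^-1 * (p%:R ^+ 2 * (a * a) - p%:R ^+ 2 * b) by field.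
  apply: pow_dvdD.
    by apply: (pow_dvdD h); rewrite (pow_dvd_pM 1 2); exact: h1.
  apply: (pow_dvdMl ih); apply: pow_dvdB.
    by rewrite (pow_dvd_pM 2 1); apply: (@pow_dvd_leq 1 4) => //; exact: (pow_dvdM h1 h1).
  by rewrite (pow_dvd_pM 2 1); exact: h2.
split; first exact: w3.
pose t i : rat := i%:R^-1 * (p - i)%:R^-1.
have it i : (1 <= i < p)%N -> O 0 (t i).
  move=> hi; have iy : O 0 i%:R^-1 by apply: pow_dvd_inv.
  have iz : O 0 (p - i)%:R^-1 by apply: pow_dvd_inv; lia.
  by rewrite /t; integral.
pose T1 := \sum_(1 <= i < p) t i; pose T2 := \sum_(1 <= i < p) t i ^+ 2.
(* Since p/(i (p - i)) = 1/i + 1/(p - i), Wolstenholme's congruence makes [T1] divisible by p. *)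
have eT1 : p%:R ^+ 1 * T1 = 2 * H 1.
  have -> : 2 * H 1 = \sum_(1 <= j < p) (j%:R^-1 + (p - j)%:R^-1).
    by rewrite mulr_natl mulr2n {2}sum_nat_rev -big_split.
  rewrite mulr_sumr; apply: eq_big_nat => i hi; rewrite /t.
  have e := inverse_rev hi; set y := i%:R^-1 in e *; set z := _^-1 in e *.
  by rewrite {2}e; ring.
have hT1 : O 1 T1.
  by rewrite -(pow_dvd_pM 1 1) eT1; apply: pow_dvdMl; [integral | exact: h1].
have hT2 : O 2 (T2 - H 4).
  apply: (@pow_dvd_sub _ (p%:R ^+ 1 * (2 * H 5))); last first.
    by rewrite (pow_dvd_pM 1 1); apply: pow_dvdMl; [integral | exact: h5].
  rewrite !mulr_sumr -!sumrB; apply: pow_dvd_sum_nat => i hi; rewrite /t.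
  have := inverse_rev_mod2 hi; have iy : O 0 i%:R^-1 by apply: pow_dvd_inv.
  have iz : O 0 (p - i)%:R^-1 by apply: pow_dvd_inv; lia.
  set y := i%:R^-1 in iy *; set z := _^-1 in iz * => h.
  have iw : O 0 (- (y + p%:R * y ^+ 2)) by integral.
  have {}h := pow_dvd_subX 2 iz iw h.
  have -> : (y * z) ^+ 2 - y ^+ 4 - p%:R ^+ 1 * (2 * y ^+ 5) =
     y ^+ 2 * (z ^+ 2 - (- (y + p%:R * y ^+ 2)) ^+ 2) + p%:R ^+ 2 * y ^+ 6 by ring.
  by apply: pow_dvdD; [apply: pow_dvdMl; [integral | exact: h]
                        | apply: pow_dvd_mulp; integral].
have hu i : (1 <= i < p)%N -> O 2 (2 * p%:R ^+ 2 * t i).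
  move=> hi; rewrite (_ : _ * _ = p%:R ^+ 2 * (2 * t i)); last by ring.
  by have iti := it i hi; apply: pow_dvd_mulp; integral.
have := prod_second_order hu; rewrite -prod_add_square -mulr_sumr -/T1.
have -> : \sum_(1 <= i < p) (2 * p%:R ^+ 2 * t i) ^+ 2 = 4 * p%:R ^+ 4 * T2.
  by rewrite mulr_sumr; apply: eq_bigr => i _; ring.
move: eT1 hT2 w3; set a := H 1; set b := H 4; set P := Pi => eT1 hT2 w3 h.
have -> : P - 1 - (2 * p%:R * a - p%:R ^+ 4 * b) = 2%:R^-1 *
   ((P ^+ 2 - (1 + 2 * p%:R ^+ 2 * T1
        + ((2 * p%:R ^+ 2 * T1) ^+ 2 - 4 * p%:R ^+ 4 * T2) / 2))
    + p%:R ^+ 4 * (2 * (T1 * T1)) - p%:R ^+ 4 * (2 * (T2 - b)) - (P - 1) * (P - 1)).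
  have -> : 2 * p%:R ^+ 2 * T1 = 2 * p%:R * (2 * a) by rewrite -eT1; ring.
  have e : (2 * p%:R * (2 * a)) ^+ 2 = 4 * p%:R ^+ 4 * T1 ^+ 2.
    by rewrite -eT1; ring.
  by rewrite e; field.
apply: (pow_dvdMl ih); apply: pow_dvdB; last exact: (pow_dvdM w3 w3).
apply: pow_dvdB.
  apply: (pow_dvdD h); rewrite (pow_dvd_pM 4 2); apply: pow_dvdMl; first by integral.
  exact: (pow_dvdM hT1 hT1).
by rewrite (pow_dvd_pM 4 2); apply: pow_dvdMl; [integral | exact: hT2].
Qed.

(** * The values beta_p and beta_(p-1) modulo p^6 *)

Lemma beta_sum_shift x :
  \sum_(0 <= k < p) beta_prod x k.+1 * (p%:R / k.+1%:R) ^+ 3 =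
  \sum_(1 <= j < p) beta_prod x j * (p%:R / j%:R) ^+ 3 + beta_prod x p.
Proof.
rewrite -(big_add1 _ _ 0 p.+1 xpredT (fun j => beta_prod x j * (p%:R / j%:R) ^+ 3)).
(* The index j = p is split off because p/j = 1 there. *)
by rewrite big_nat_recr ?prime_gt0 //= divff // expr1n mulr1.
Qed.

(** The two linear combinations, of determinant -10, are solved for beta_p and beta_(p-1). The
    congruences for the harmonic sums then leave only H_(p-1) and B_(p-5). *)
Lemma beta_mod6 :
  O 6 ((beta p)%:R - (3 + 5 * p%:R * H 1 + 3 / 2 * p%:R ^+ 5 * B)) /\
  O 6 ((beta p.-1)%:R - (1 - 5 * p%:R * H 1 + 5 / 2 * p%:R ^+ 5 * B)).
Proof.
have ih := half_integral; have iB := bernoulli_integral.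
have pE : p.-1.+1 = p by rewrite prednK ?prime_gt0.
have ev : ~~ odd p.-1 by rewrite -[odd _]negbK -oddS pE p_odd.
have := beta_combination_pos p.-1; have := beta_combination_neg p.-1 ev.
have bp : beta_prod p%:R p = Pi by rewrite -beta_prod_p mulr1.
have bn : beta_prod (- p%:R) p = Pi ^+ 2 by rewrite -beta_prodN_p mulrN1.
have i1 : O 0 (-1) by integral.
have := beta_prod_sum_mod6 i1; have := beta_prod_sum_mod6 pow_dvd1.
rewrite !mulr1 !mulrN1 !pE !beta_sum_shift bp bn.
have [w3 hw] := prod_add_mod6; have w6 := pow_dvdM w3 w3.
move: cubic_inverse_sum harmonic_cubic_sum harmonic_square_cubic_sum.
move: harmonic_quartic_sum square_cubic_sum quartic_inverse_sum w3 hw w6.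
have -> : hs 4 = H 4 by apply: eq_bigr => i _; rewrite exprVn.
move: iB; set b := B => iB.
set P := Pi; set h1 := H 1; set h3 := H 3; set h4 := H 4; set x := X; set y := Y.
set u := U; set v := V; set S := \sum_(1 <= j < p) _; set S' := \sum_(1 <= j < p) _.
set B1 := (beta p)%:R; set B0 := (beta p.-1)%:R.
move=> hU hV hH4 w3 hw w6 hH3 hX hY hS hS' eN eP.
have eB1 : B1 = 1 + (3 * (S + P) + (S' + P ^+ 2)) / 2.
  have e : 10 * B1 = 3 * (3 * B1 + B0) + (B1 - 3 * B0) by ring.
  have nz : 10 != 0 :> rat by [].
  by apply: (mulfI nz); rewrite e eN eP; field.
have eB0 : B0 = 2 + ((S + P) - 3 * (S' + P ^+ 2)) / 2.
  have e : 10 * B0 = (3 * B1 + B0) - 3 * (B1 - 3 * B0) by ring.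
  have nz : 10 != 0 :> rat by [].
  by apply: (mulfI nz); rewrite e eN eP; field.
move: hS hS' hw w6; set q : rat := p%:R => hS hS' hw w6.
split.
  (* Each summand is a proved congruence times the power of p that lifts it to p^6. The coefficients
     eliminate [h3], [x], [h4], [y], [u] and [v]. *)
  have -> : B1 - (3 + 5 * q * h1 + 3 / 2 * q ^+ 5 * b) = 2%:R^-1 *
      (3 * (S - q ^+ 3 * (h3 - q * x + q ^+ 2 * (y - 3 * v) / 2))
       + (S' - q ^+ 3 * (h3 - - q * x + (- q) ^+ 2 * (y - 3 * v) / 2))
       + 5 * (P - 1 - (2 * q * h1 - q ^+ 4 * h4)) + (P - 1) * (P - 1)
       + q ^+ 3 * (2 * (2 * h3 + 3 * q * h4))
       - q ^+ 4 * (2 * x + h4 + q * v + 3 * q * u)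
       - q ^+ 4 * (2 * (5 * h4 - 4 * (q * b)))
       + q ^+ 5 * (2 * (y + u) + (u - b) - 5 * (v + 2 * b))).
    by rewrite eB1; field.
  apply: (pow_dvdMl ih); apply: pow_dvdD; last first.
    rewrite (pow_dvd_pM 5 1); apply: pow_dvdB; last first.
      by apply: pow_dvdMl; [integral | exact: hV].
    by apply: pow_dvdD; [apply: pow_dvdMl; [integral | exact: hY] | exact: hU].
  apply: pow_dvdB; last first.
    by rewrite (pow_dvd_pM 4 2); apply: pow_dvdMl; [integral | exact: hH4].
  apply: pow_dvdB; last by rewrite (pow_dvd_pM 4 2); exact: hX.
  apply: pow_dvdD; last first.
    by rewrite (pow_dvd_pM 3 3); apply: pow_dvdMl; [integral | exact: hH3].
  apply: pow_dvdD; last exact: w6.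
  apply: pow_dvdD; last by apply: pow_dvdMl; [integral | exact: hw].
  by apply: pow_dvdD; [apply: pow_dvdMl; [integral | exact: hS] | exact: hS'].
have -> : B0 - (1 - 5 * q * h1 + 5 / 2 * q ^+ 5 * b) = 2%:R^-1 *
    ((S - q ^+ 3 * (h3 - q * x + q ^+ 2 * (y - 3 * v) / 2))
     - 3 * (S' - q ^+ 3 * (h3 - - q * x + (- q) ^+ 2 * (y - 3 * v) / 2))
     - 5 * (P - 1 - (2 * q * h1 - q ^+ 4 * h4)) - 3 * ((P - 1) * (P - 1))
     - q ^+ 3 * (2 * h3 + 3 * q * h4)
     - q ^+ 4 * (2 * (2 * x + h4 + q * v + 3 * q * u))
     + q ^+ 4 * (2 * (5 * h4 - 4 * (q * b)))
     + q ^+ 5 * (7 * (u - b) + 5 * (v + 2 * b) - (y + u))).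
  by rewrite eB0; field.
apply: (pow_dvdMl ih); apply: pow_dvdD; last first.
  rewrite (pow_dvd_pM 5 1); apply: pow_dvdB; last exact: hY.
  by apply: pow_dvdD; apply: pow_dvdMl; [integral | exact: hU | integral | exact: hV].
apply: pow_dvdD; last first.
  by rewrite (pow_dvd_pM 4 2); apply: pow_dvdMl; [integral | exact: hH4].
apply: pow_dvdB; last first.
  by rewrite (pow_dvd_pM 4 2); apply: pow_dvdMl; [integral | exact: hX].
apply: pow_dvdB; last by rewrite (pow_dvd_pM 3 3); exact: hH3.
apply: pow_dvdB; last by apply: pow_dvdMl; [integral | exact: w6].
apply: pow_dvdB; last by apply: pow_dvdMl; [integral | exact: hw].
by apply: pow_dvdB; [exact: hS | apply: pow_dvdMl; [integral | exact: hS']].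
Qed.

(** * The three congruences modulo p^8 *)

Lemma beta_sum_congruences_gt5 : beta_sum_congruences p.
Proof.
have [h1 h0] := beta_mod6; have ih := half_integral.
have iH : O 0 (harmonic p.-1) by apply: pow_dvd_sum_nat => i hi; apply: pow_dvd_inv; lia.
have iB : O 0 (bernoulli (p - 5)) by apply: bernoulli_integral.
have pE : p.-1.+1 = p by rewrite prednK ?prime_gt0.
have eH : H 1 = harmonic p.-1 by rewrite /harmonic pE.
have sgn : (-1) ^+ p.-1 = 1 :> rat.
  by rewrite -signr_odd -[odd _]negbK -oddS pE p_odd.
have := sum_beta_plus p.-1; have := sum_beta_alt p.-1; have := sum_beta_alt_cube p.-1.
move: h1 h0; rewrite pE sgn eH !mul1r; set q : rat := p%:R; set h := harmonic _.
set b := bernoulli _; set x := (beta p)%:R; set y := (beta p.-1)%:R => h1 h0.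
rewrite /beta_sum_congruences => -> -> ->.
split; (apply: pow_dvd_eqmod; [by rewrite -pow_dvd0E; integral|]).
- have -> : q ^+ 2 * (x + y) - (4 * q ^+ 2 + 4 * q ^+ 7 * b) =
    q ^+ 2 * ((x - (3 + 5 * q * h + 3 / 2 * q ^+ 5 * b))
              + (y - (1 - 5 * q * h + 5 / 2 * q ^+ 5 * b))) by field.
  by rewrite (pow_dvd_pM 2 6); apply: (pow_dvdD h1 h0).
- have -> : q ^+ 2 * (x - y) - (2 * q ^+ 2 + 10 * q ^+ 3 * h - q ^+ 7 * b) =
    q ^+ 2 * ((x - (3 + 5 * q * h + 3 / 2 * q ^+ 5 * b))
              - (y - (1 - 5 * q * h + 5 / 2 * q ^+ 5 * b))) by field.
  by rewrite (pow_dvd_pM 2 6); apply: (pow_dvdB h1 h0).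
(* The term -p^5 B_(p-5) of x - y, multiplied by p^3, is absorbed by the modulus; it appears as
   [q ^+ 6 * b] inside the factor [q ^+ 2]. *)
have -> : q ^+ 3 * (x - y) - q ^+ 2 * x - (2 * q ^+ 3 - 3 * q ^+ 2
           + (10 * q - 5) * q ^+ 3 * h - 3 / 2 * q ^+ 7 * b) =
    q ^+ 2 * (q * ((x - (3 + 5 * q * h + 3 / 2 * q ^+ 5 * b))
              - (y - (1 - 5 * q * h + 5 / 2 * q ^+ 5 * b)))
              - (x - (3 + 5 * q * h + 3 / 2 * q ^+ 5 * b)) - q ^+ 6 * b).
  by field.
rewrite (pow_dvd_pM 2 6); apply: pow_dvdB; last exact: (pow_dvd_mulp 6 iB).
apply: pow_dvdB; last exact: h1.
exact: (pow_dvdMl (pow_dvd_nat p) (pow_dvdB h1 h0)).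
Qed.

End PAdic.

Unset Implicit Arguments.

Theorem theorem1p2 (p : nat) (p_prime : prime p) (p_gt3 : (3 < p)%N) :
  [/\ eqmod_pow p 8
        (\sum_(0 <= k < p)
           (11 * k%:R ^+ 2 + 13 * k%:R + 4) * (beta k)%:R)
        (4 * p%:R ^+ 2 + 4 * p%:R ^+ 7 * bernoulli (p - 5)),
      eqmod_pow p 8
        (\sum_(0 <= k < p)
           (11 * k%:R ^+ 2 + 9 * k%:R + 2) * (-1) ^+ k * (beta k)%:R)
        (2 * p%:R ^+ 2 + 10 * p%:R ^+ 3 * harmonic p.-1
           - p%:R ^+ 7 * bernoulli (p - 5))
    & eqmod_pow p 8
        (\sum_(0 <= k < p)
           (11 * k%:R ^+ 3 + 7 * k%:R ^+ 2 - 1) * (-1) ^+ k * (beta k)%:R)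
        (2 * p%:R ^+ 3 - 3 * p%:R ^+ 2
           + (10 * p%:R - 5) * p%:R ^+ 3 * harmonic p.-1
           - 3 / 2 * p%:R ^+ 7 * bernoulli (p - 5))].
Proof.
have [p_le5 | p_gt5] := leqP p 5; last exact: beta_sum_congruences_gt5.
apply: beta_sum_congruences_5 => //; move: p_prime.
by case: (p =P 4) => [-> // | p_neq4 _]; lia.
Qed.
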